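(* For every $\epsilon\in(0,1)$, $$\log M^*_{\mathrm{vf}}(\bar n,\epsilon)\ \ge\ \frac{\bar nC}{1-\epsilon}+\mathcal O(\bar n^{1/3}\log\bar n)\qquad(\bar n\to\infty),$$ i.e., there exist constants $K,\bar n_0$ such that $\log M^*_{\mathrm{vf}}(\bar n,\epsilon)\ge\frac{\bar nC}{1-\epsilon}-K\bar n^{1/3}\log\bar n$ for all $\bar n\ge\bar n_0$.
   Context: Setting (CM-DMBC): finite alphabets $\mathcal X=\{1,\dots,N\}$, $\mathcal Y$; transition matrices $W_1,W_2$; given input $x$ the outputs are $(y_1,y_2)$ with probability $W_1(y_1|x)W_2(y_2|x)$, memoryless. $PW_k(y)=\sum_xP(x)W_k(y|x)$, $I_k(P)=\sum_xP(x)D(W_k(\cdot|x)\|PW_k)$ (natural logarithms), $V_k(P)=\sum_xP(x)\mathrm{Var}[\log\frac{W_k(Y_k|x)}{PW_k(Y_k)}]$ with $Y_k\sim W_k(\cdot|x)$. $C=\max_P\min_kI_k(P)$, $C_k=\max_PI_k(P)$. Standing assumptions: the maximizer $P^*$ of $\min_kI_k$ is unique, $P^*(x)>0$ for all $x$, $V_k(P^* )>0$ and $C_k>C$ for $k=1,2$. An $(\bar n,M,\epsilon)$-VLF code consists of: (1) a random variable $U$ on a set $\mathcal U$ with $|\mathcal U|\le3$, known at encoder and decoders; (2) encoding functions $f_i:\mathcal U\times\{1,\dots,M\}\times\mathcal Y^{i-1}\times\mathcal Y^{i-1}\to\mathcal X$, $X_i=f_i(U,J,Y_1^{i-1},Y_2^{i-1})$,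 with $J$ uniform on $\{1,\dots,M\}$; (3) nonnegative integer-valued random variables $\tau_1,\tau_2$, $\tau_k$ a stopping time of the filtration $\sigma(U,Y_k^i)$, with $\mathbb E[\max_k\tau_k]\le\bar n$; (4) decoders $g_{k,i}:\mathcal U\times\mathcal Y^i\to\{1,\dots,M\}$ with $\mathbb P[J\ne g_{k,\tau_k}(U,Y_k^{\tau_k})]\le\epsilon$, $k=1,2$. $M^*_{\mathrm{vf}}(\bar n,\epsilon)$ is the largest $M$ for which an $(\bar n,M,\epsilon)$-VLF code exists. *)

(* Defs.v *)
From Stdlib Require Import Reals List Arith Bool.
Open Scope R_scope.

(* Conventions: input alphabet X = {0,..,N-1}, output alphabet Y = {0,..,L-1}
   (shifted from {1,..,N}); a transition matrix is W : nat -> nat -> R with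
   W x y = W(y|x). Messages are {0,..,M-1}, common randomness values {0,..,nU-1}. *)

Fixpoint fsum (n : nat) (f : nat -> R) : R :=
  match n with O => 0 | S m => fsum m f + f m end.

Fixpoint fprod (n : nat) (f : nat -> R) : R :=
  match n with O => 1 | S m => fprod m f * f m end.

Fixpoint seqsum (L n : nat) (F : list nat -> R) {struct n} : R :=
  match n with
  | O => F nil
  | S m => fsum L (fun y => seqsum L m (fun s => F (y :: s)))
  end.

Definition distr (N : nat) (P : nat -> R) : Prop :=
  (forall x, (x < N)%nat -> 0 <= P x) /\ fsum N P = 1.

Definition stoch (N L : nat) (W : nat -> nat -> R) : Prop :=
  forall x, (x < N)%nat ->
    (forall y, (y < L)%nat -> 0 <= W x y) /\ fsum L (W x) = 1.

Definition outd (N : nat) (P : nat -> R) (W : nat -> nat -> R) (y : nat) : R :=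
  fsum N (fun x => P x * W x y).

Definition idens N (P : nat -> R) (W : nat -> nat -> R) (x y : nat) : R :=
  ln (W x y / outd N P W y).

Definition info (N L : nat) (P : nat -> R) (W : nat -> nat -> R) : R :=
  fsum N (fun x => P x * fsum L (fun y => W x y * idens N P W x y)).

Definition disp (N L : nat) (P : nat -> R) (W : nat -> nat -> R) : R :=
  fsum N (fun x => P x *
    (fsum L (fun y => W x y * (idens N P W x y) ^ 2)
     - (fsum L (fun y => W x y * idens N P W x y)) ^ 2)).

(* Encoder: enc u j y1 y2 = X_i when (y1,y2) = (Y_1^{i-1}, Y_2^{i-1});
   the time index i is (length y1) + 1. *)

(* probability of output prefixes (y1, y2) (of equal length n) given U=u, J=j *)
Definition chprob (W1 W2 : nat -> nat -> R)
  (enc : nat -> nat -> list nat -> list nat -> nat)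
  (u j : nat) (y1 y2 : list nat) : R :=
  fprod (length y1) (fun i =>
    let x := enc u j (firstn i y1) (firstn i y2) in
    W1 x (nth i y1 O) * W2 x (nth i y2 O)).

(* A stopping time tau of sigma(U, Y^i) is given by a stopping rule
   stop : nat -> list nat -> bool, tau = least i with stop u (Y^i) = true. *)
Definition stops_at (stop : nat -> list nat -> bool) (u : nat) (y : list nat)
  (n : nat) : bool :=
  stop u (firstn n y) && forallb (fun i => negb (stop u (firstn i y))) (seq O n).

Definition stopped_by (stop : nat -> list nat -> bool) (u : nat) (y : list nat)
  (n : nat) : bool :=
  existsb (fun i => stop u (firstn i y)) (seq O (S n)).

Definition prob_event (L nU : nat) (PU : nat -> R) (M : nat)
  (W1 W2 : nat -> nat -> R) (enc : nat -> nat -> list nat -> list nat -> nat)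
  (n : nat) (E : nat -> nat -> list nat -> list nat -> bool) : R :=
  fsum nU (fun u => PU u * fsum M (fun j => / INR M *
    seqsum L n (fun y1 => seqsum L n (fun y2 =>
      chprob W1 W2 enc u j y1 y2 * (if E u j y1 y2 then 1 else 0))))).

Definition is_vlf_code (N L : nat) (W1 W2 : nat -> nat -> R)
  (nbar : R) (M : nat) (eps : R)
  (nU : nat) (PU : nat -> R) (enc : nat -> nat -> list nat -> list nat -> nat)
  (stop1 stop2 : nat -> list nat -> bool) (dec1 dec2 : nat -> list nat -> nat)
  : Prop :=
  (1 <= M)%nat /\
  (1 <= nU <= 3)%nat /\ distr nU PU /\
  (forall u j y1 y2, (enc u j y1 y2 < N)%nat) /\
  (forall u y, (dec1 u y < M)%nat) /\ (forall u y, (dec2 u y < M)%nat) /\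
  (* (3) E[max(tau1,tau2)] = sum_{n>=0} P[max(tau1,tau2) > n] <= nbar *)
  (forall T : nat,
     fsum T (fun n => prob_event L nU PU M W1 W2 enc n
       (fun u j y1 y2 => negb (stopped_by stop1 u y1 n && stopped_by stop2 u y2 n)))
     <= nbar) /\
  (* (4) P[J <> g_{k,tau_k}(U, Y_k^{tau_k})] = sum_n P[tau_k = n, error] <= eps *)
  (forall T : nat,
     fsum T (fun n => prob_event L nU PU M W1 W2 enc n
       (fun u j y1 y2 => stops_at stop1 u y1 n && negb (Nat.eqb (dec1 u y1) j)))
     <= eps) /\
  (forall T : nat,
     fsum T (fun n => prob_event L nU PU M W1 W2 enc n
       (fun u j y1 y2 => stops_at stop2 u y2 n && negb (Nat.eqb (dec2 u y2) j)))
     <= eps).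

Definition vlf_code_exists (N L : nat) (W1 W2 : nat -> nat -> R)
  (nbar : R) (M : nat) (eps : R) : Prop :=
  exists nU PU enc stop1 stop2 dec1 dec2,
    is_vlf_code N L W1 W2 nbar M eps nU PU enc stop1 stop2 dec1 dec2.

(* log M*_vf(nbar, eps) >= b  <->  some (nbar, M, eps)-VLF code has log M >= b *)
Definition logMstar_ge (N L : nat) (W1 W2 : nat -> nat -> R)
  (nbar eps b : R) : Prop :=
  exists M, vlf_code_exists N L W1 W2 nbar M eps /\ b <= ln (INR M).

(* Main.v *)
Require Import Defs.
From Stdlib Require Import Reals List Arith Bool ZArith Lra Lia.
From Stdlib Require Import Classical FunctionalExtensionality.
Open Scope R_scope.

(** Optimality of [Pstar] together with [C < C_k] forces [I_1 = I_2 = C] at [Pstar] and makes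
    the gradients of [I_1] and [I_2] there point in opposite directions. Hence moving [Pstar]
    by [1/r] along that direction shifts [I_1 - I_2] by order [1/r], while a fixed convex
    combination of [I_1] and [I_2] drops by only [O(1/r^2)].

    With [r = nbar^(1/3)], time is cut into blocks of length [r^2]. In each block the encoder,
    which sees both outputs, uses letters drawn from one of the two perturbed distributions, so
    as to help the receiver whose information density lags. The densities then stay within
    [O(r log nbar)] of each other, which an exponential potential shows, and optional stopping
    bounds the expected time until both exceed [gam] by [gam / C + O(r log nbar)]. The
    receivers do not know the encoder's binary choices and decode by a union over all of them;
    there are only [O(r)] blocks, so this costs [O(r)] in [log M]. Finally, stopping at time 0
    with probability about [eps] gains the factor [1 / (1 - eps)]. *)

(** * Finite sums *)

(** The exponent 1/3 balances three losses. Perturbing the input law by [d] costs [n d^2] in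
    information. A drift of order [d] beats the second-order term of an exponential moment only for
    a parameter of order [d], so the gap between the densities is controlled at scale [log n / d].
    Blocks of length [B] leave [n / B] unknown switches, and [B] cannot exceed the order [1 / d^2],
    or the potential would grow too much inside a block spent in the wrong mode. With [d = n^(-1/3)]
    and [B = n^(2/3)] all three are [n^(1/3)] up to a logarithm.

    The transmitted symbols depend on the feedback, but the codewords must not: a wrong codeword has
    to be independent of the outputs for the change of measure behind the error bound. Hence
    codewords made of pairs of inputs, drawn before any switch is known.

    Codewords are cut at a length [T] of order [n], so every expectation is a finite sum; not having
    finished by time [T] is exponentially unlikely. *)

Lemma fsum_ext n f g :
  (forall i, (i < n)%nat -> f i = g i) -> fsum n f = fsum n g.
Proof.
  induction n as [|n IH]; intros H; simpl; [reflexivity|].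
  rewrite IH, H; auto; intros; apply H; lia.
Qed.

Lemma fsum_add n f g : fsum n (fun i => f i + g i) = fsum n f + fsum n g.
Proof. induction n as [|n IH]; simpl; [lra|rewrite IH; lra]. Qed.

Lemma fsum_scal n c f : fsum n (fun i => c * f i) = c * fsum n f.
Proof. induction n as [|n IH]; simpl; [lra|rewrite IH; lra]. Qed.

Lemma fsum_sub n f g : fsum n (fun i => f i - g i) = fsum n f - fsum n g.
Proof. induction n as [|n IH]; simpl; [lra|rewrite IH; lra]. Qed.

Lemma fsum_le n f g :
  (forall i, (i < n)%nat -> f i <= g i) -> fsum n f <= fsum n g.
Proof.
  induction n as [|n IH]; intros H; simpl; [lra|].
  apply Rplus_le_compat; [apply IH; intros|]; apply H; lia.
Qed.

Lemma fsum_const n c : fsum n (fun _ => c) = INR n * c.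
Proof.
  induction n as [|n IH]; [simpl; lra|].
  rewrite S_INR; simpl; rewrite IH; lra.
Qed.

Lemma fsum_zero n f : (forall i, (i < n)%nat -> f i = 0) -> fsum n f = 0.
Proof. intros H; rewrite (fsum_ext n f (fun _ => 0)), fsum_const; [lra|exact H]. Qed.

Lemma fsum_nonneg n f : (forall i, (i < n)%nat -> 0 <= f i) -> 0 <= fsum n f.
Proof.
  intros H; rewrite <- (fsum_zero n (fun _ => 0)); [|reflexivity].
  apply fsum_le; exact H.
Qed.

Lemma fsum_ge_term n f i :
  (forall i, (i < n)%nat -> 0 <= f i) -> (i < n)%nat -> f i <= fsum n f.
Proof.
  induction n as [|n IH]; intros H Hi; [lia|]; simpl.
  assert (0 <= fsum n f) by (apply fsum_nonneg; intros; apply H; lia).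
  assert (0 <= f n) by (apply H; lia).
  destruct (Nat.eq_dec i n) as [->|]; [lra|].
  assert (f i <= fsum n f) by (apply IH; [intros; apply H|]; lia); lra.
Qed.

Lemma fsum_nonneg_zero n f :
  (forall i, (i < n)%nat -> 0 <= f i) -> fsum n f <= 0 ->
  forall i, (i < n)%nat -> f i = 0.
Proof.
  intros H H0 i Hi; pose proof (fsum_ge_term n f i H Hi); pose proof (H i Hi); lra.
Qed.

Lemma fsum_swap n m (f : nat -> nat -> R) :
  fsum n (fun i => fsum m (fun j => f i j)) = fsum m (fun j => fsum n (fun i => f i j)).
Proof.
  induction n as [|n IH]; simpl; [symmetry; apply fsum_zero; reflexivity|].
  now rewrite IH, <- fsum_add.
Qed.

Lemma fsum_truncate n m f :
  (m <= n)%nat -> (forall i, (m <= i < n)%nat -> f i = 0) -> fsum n f = fsum m f.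
Proof.
  intros Hm; induction Hm as [|n Hm IH]; intros H; [reflexivity|].
  simpl; rewrite IH, H by (intros; (apply H || idtac); lia); lra.
Qed.

Lemma fsum_mono_nonneg n m f :
  (n <= m)%nat -> (forall i, (i < m)%nat -> 0 <= f i) -> fsum n f <= fsum m f.
Proof.
  intros Hm; induction Hm as [|m Hm IH]; intros H; [lra|].
  simpl; assert (fsum n f <= fsum m f) by (apply IH; intros; apply H; lia).
  assert (0 <= f m) by (apply H; lia); lra.
Qed.

Lemma fprod_ext n f g :
  (forall i, (i < n)%nat -> f i = g i) -> fprod n f = fprod n g.
Proof.
  induction n as [|n IH]; intros H; simpl; [reflexivity|].
  rewrite IH, H; auto; intros; apply H; lia.
Qed.

Lemma fprod_nonneg n f : (forall i, (i < n)%nat -> 0 <= f i) -> 0 <= fprod n f.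
Proof.
  induction n as [|n IH]; intros H; simpl; [lra|].
  apply Rmult_le_pos; [apply IH; intros|]; apply H; lia.
Qed.

(** * Expectation functionals *)

Definition linear_functional {A} (E : (A -> R) -> R) : Prop :=
  (forall F G, E (fun a => F a + G a) = E F + E G) /\
  (forall c F, E (fun a => c * F a) = c * E F).

(* [supp] is a set of full measure: all pointwise hypotheses need only hold there.
   [exp_comm] is the form of Fubini's theorem that composes well. *)
Record expectation {A} (supp : A -> Prop) (E : (A -> R) -> R) : Prop := {
  exp_linear : linear_functional E;
  exp_mono : forall F G, (forall a, supp a -> F a <= G a) -> E F <= E G;
  exp_one : E (fun _ => 1) = 1;
  exp_attained : forall F v, E F <= v -> exists a, supp a /\ F a <= v;
  exp_comm : forall B (T : (B -> R) -> R), linear_functional T -> forall F : A -> B -> R,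
    T (fun b => E (fun a => F a b)) = E (fun a => T (F a)) }.

Section ExpectationFacts.

Context {A : Type} (supp : A -> Prop) (E : (A -> R) -> R) (HE : expectation supp E).

Lemma exp_add F G : E (fun a => F a + G a) = E F + E G.
Proof. apply (exp_linear _ _ HE). Qed.

Lemma exp_scal c F : E (fun a => c * F a) = c * E F.
Proof. apply (exp_linear _ _ HE). Qed.

Lemma exp_ext F G : (forall a, supp a -> F a = G a) -> E F = E G.
Proof.
  intros H; apply Rle_antisym; apply (exp_mono _ _ HE); intros a Ha; rewrite (H a Ha); lra.
Qed.

Lemma exp_const c : E (fun _ => c) = c.
Proof.
  rewrite (exp_ext _ (fun _ => c * 1)) by (intros; ring).
  rewrite exp_scal, (exp_one _ _ HE); lra.
Qed.

Lemma exp_le_const F c : (forall a, supp a -> F a <= c) -> E F <= c.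
Proof. intros H; rewrite <- (exp_const c); now apply (exp_mono _ _ HE). Qed.

Lemma exp_ge_const F c : (forall a, supp a -> c <= F a) -> c <= E F.
Proof. intros H; rewrite <- (exp_const c); now apply (exp_mono _ _ HE). Qed.

Lemma exp_fsum n (F : nat -> A -> R) :
  E (fun a => fsum n (fun i => F i a)) = fsum n (fun i => E (F i)).
Proof.
  induction n as [|n IH]; simpl; [apply exp_const|]; now rewrite exp_add, IH.
Qed.

End ExpectationFacts.

Lemma linear_fsum {A} (E : (A -> R) -> R) : linear_functional E ->
  forall n (F : nat -> A -> R),
  E (fun a => fsum n (fun i => F i a)) = fsum n (fun i => E (F i)).
Proof.
  intros [Ha Hs]; induction n as [|n IH]; intros F; simpl.
  - pose proof (Hs 0 (fun _ => 0)) as H; rewrite Rmult_0_l, Rmult_0_l in H; exact H.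
  - now rewrite Ha, IH.
Qed.

Definition wsum (n : nat) (p : nat -> R) (F : nat -> R) : R :=
  fsum n (fun x => p x * F x).

Lemma wsum_expectation n p : distr n p ->
  expectation (fun x => (x < n)%nat /\ 0 < p x) (wsum n p).
Proof.
  intros [Hp H1]; split.
  - split; intros; unfold wsum.
    + rewrite <- fsum_add; apply fsum_ext; intros; lra.
    + rewrite <- fsum_scal; apply fsum_ext; intros; lra.
  - intros F G H; apply fsum_le; intros i Hi.
    destruct (Rle_lt_or_eq_dec 0 (p i) (Hp i Hi)) as [Hpos|Hz].
    + apply Rmult_le_compat_l; [lra|]; apply H; auto.
    + rewrite <- Hz; lra.
  - unfold wsum; transitivity (fsum n p); [apply fsum_ext; intros; lra|exact H1].
  - intros F v Hv.
    destruct (classic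
      (exists a, ((a < n)%nat /\ 0 < p a) /\ F a <= v)) as [?|Hno]; [assumption|exfalso].
    assert (Hz : forall i, (i < n)%nat -> p i * (F i - v) >= 0 /\ (0 < p i -> v < F i)).
    { intros i Hi.
      assert (Hi' : 0 < p i -> v < F i).
      { intros Hpi; destruct (Rle_lt_dec (F i) v); [|assumption].
        exfalso; apply Hno; exists i; auto. }
      split; [|exact Hi'].
      destruct (Rle_lt_or_eq_dec 0 (p i) (Hp i Hi)) as [Hpos|Hzz].
      - specialize (Hi' Hpos); nra.
      - rewrite <- Hzz; lra. }
    (* These terms are nonnegative with sum at most 0, so all vanish; as [F > v] wherever [p > 0],
       no mass would be left. *)
    assert (Hs : fsum n (fun i => p i * (F i - v)) <= 0).
    { rewrite (fsum_ext n _ (fun i => p i * F i - v * p i)) by (intros; lra).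
      rewrite fsum_sub, fsum_scal, H1; unfold wsum in Hv; lra. }
    assert (H0 : fsum n p = 0).
    { apply fsum_zero; intros i Hi.
      pose proof (fsum_nonneg_zero n (fun i => p i * (F i - v))
        (fun j Hj => Rge_le _ _ (proj1 (Hz j Hj))) Hs i Hi) as Hq; simpl in Hq.
      destruct (Rle_lt_or_eq_dec 0 (p i) (Hp i Hi)) as [Hpos|Hzz]; [|auto].
      pose proof (proj2 (Hz i Hi) Hpos); nra. }
    lra.
  - intros B T HT F; unfold wsum.
    rewrite linear_fsum by assumption; apply fsum_ext; intros; apply HT.
Qed.

(** Composition of a law with a kernel, pushed forward by [f]. Letters, channel outputs, words,
    output paths and the state chain are all assembled with it. *)
Lemma expectation_bind {A B C} (S : A -> Prop) (E : (A -> R) -> R)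
  (S' : A -> B -> Prop) (K : A -> (B -> R) -> R) (f : A -> B -> C) (U : C -> Prop) :
  expectation S E -> (forall a, S a -> expectation (S' a) (K a)) ->
  (forall a b, S a -> S' a b -> U (f a b)) ->
  expectation U (fun F => E (fun a => K a (fun b => F (f a b)))).
Proof.
  intros HE HK HU; split.
  - split; intros.
    + rewrite <- (exp_add S E HE); apply (exp_ext S E HE); intros a Ha.
      apply (exp_add _ _ (HK a Ha) (fun b => F (f a b)) (fun b => G (f a b))).
    + rewrite <- (exp_scal S E HE); apply (exp_ext S E HE); intros a Ha.
      apply (exp_scal _ _ (HK a Ha) c (fun b => F (f a b))).
  - intros F G H; apply (exp_mono _ _ HE); intros a Ha.
    apply (exp_mono _ _ (HK a Ha)); auto.
  - rewrite (exp_ext S E HE _ (fun _ => 1)), (exp_one _ _ HE); [reflexivity|].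
    intros a Ha; apply (exp_one _ _ (HK a Ha)).
  - intros F v Hv; apply (exp_attained _ _ HE) in Hv; destruct Hv as [a [Ha Hv]].
    apply (exp_attained _ _ (HK a Ha)) in Hv; destruct Hv as [b [Hb Hv]].
    exists (f a b); auto.
  - intros D T HT F.
    rewrite (exp_comm _ _ HE _ T HT (fun a d => K a (fun b => F (f a b) d))).
    apply (exp_ext S E HE); intros a Ha.
    apply (exp_comm _ _ (HK a Ha) _ T HT (fun b d => F (f a b) d)).
Qed.

(** * Independent letters and the random coding argument *)

Fixpoint iid {A} (E : (A -> R) -> R) (n : nat) (F : list A -> R) : R :=
  match n with
  | O => F nil
  | S m => iid E m (fun l => E (fun a => F (l ++ a :: nil)))
  end.

Lemma dirac_expectation {A} (a : A) (S : A -> Prop) : S a -> expectation S (fun F => F a).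
Proof.
  intros Ha; split; [split| | | |]; auto.
  intros F v Hv; exists a; auto.
Qed.

Section IID.

Context {A : Type} (supp : A -> Prop) (E : (A -> R) -> R) (HE : expectation supp E).

Lemma iid_expectation n :
  expectation (fun l => length l = n /\ Forall supp l) (iid E n).
Proof.
  induction n as [|n IH]; simpl.
  - now apply dirac_expectation.
  - apply (expectation_bind _ _ _ (fun _ => E) _ _ IH (fun _ _ => HE)).
    intros l a [Hl Hs] Ha; split.
    + rewrite length_app; simpl; lia.
    + apply Forall_app; auto.
Qed.

Lemma iid_firstn n m F : (n <= m)%nat -> iid E m (fun l => F (firstn n l)) = iid E n F.
Proof.
  intros Hm; induction Hm as [|m Hm IH].
  - apply (exp_ext _ _ (iid_expectation n)); intros l [Hl _]; now rewrite <- Hl, firstn_all.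
  - simpl; rewrite <- IH; apply (exp_ext _ _ (iid_expectation m)); intros l [Hl _].
    rewrite (exp_ext _ _ HE _ (fun _ => F (firstn n l))); [apply (exp_const _ _ HE)|].
    intros a _; rewrite firstn_app; replace (n - length l)%nat with 0%nat by lia.
    simpl; now rewrite app_nil_r.
Qed.

Lemma iid_nth n i d F : (i < n)%nat -> iid E n (fun l => F (nth i l d)) = E F.
Proof.
  induction n as [|n IH]; intros Hi; [lia|]; simpl.
  destruct (Nat.eq_dec i n) as [->|Hne].
  - rewrite (exp_ext _ _ (iid_expectation n) _ (fun _ => E F)).
    { apply (exp_const _ _ (iid_expectation n)). }
    intros l [Hl _]; apply (exp_ext _ _ HE); intros a _.
    now rewrite app_nth2, Hl, Nat.sub_diag by lia.
  - rewrite <- IH by lia; apply (exp_ext _ _ (iid_expectation n)); intros l [Hl _].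
    rewrite (exp_ext _ _ HE _ (fun _ => F (nth i l d))); [apply (exp_const _ _ HE)|].
    intros a _; now rewrite app_nth1 by lia.
Qed.

(** Pairwise independence is all that random coding needs: for each fixed sent word, the average
    over an independent competitor is bounded. *)
Lemma iid_nth2_le n i j d (F : A -> A -> R) v :
  (i < n)%nat -> (j < n)%nat -> i <> j -> (forall a, supp a -> E (F a) <= v) ->
  iid E n (fun l => F (nth i l d) (nth j l d)) <= v.
Proof.
  intros Hi Hj Hij HF; induction n as [|n IH]; [lia|]; simpl.
  destruct (Nat.eq_dec j n) as [->|Hj'].
  - rewrite (exp_ext _ _ (iid_expectation n) _ (fun l => E (F (nth i l d)))).
    { rewrite (iid_nth n i d (fun a => E (F a))) by lia.
      now apply (exp_le_const _ _ HE). }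
    intros l [Hl _]; apply (exp_ext _ _ HE); intros a _.
    now rewrite app_nth1, app_nth2, Hl, Nat.sub_diag by lia.
  - destruct (Nat.eq_dec i n) as [->|Hi'].
    + rewrite (exp_ext _ _ (iid_expectation n) _ (fun l => E (fun a => F a (nth j l d)))).
      { rewrite (iid_nth n j d (fun b => E (fun a => F a b))) by lia.
        (* Here the sent word is the newer coordinate, so Fubini is needed before averaging over the
           competitor. *)
        rewrite (exp_comm _ _ HE _ E (exp_linear _ _ HE)).
        now apply (exp_le_const _ _ HE). }
      intros l [Hl _]; apply (exp_ext _ _ HE); intros a _.
      now rewrite app_nth2, (app_nth1 _ _ _ (n := j)), Hl, Nat.sub_diag by lia.
    + rewrite (exp_ext _ _ (iid_expectation n) _ (fun l => F (nth i l d) (nth j l d))).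
      { apply IH; lia. }
      intros l [Hl _].
      rewrite (exp_ext _ _ HE _ (fun _ => F (nth i l d) (nth j l d)));
        [apply (exp_const _ _ HE)|].
      intros a _; now rewrite !app_nth1 by lia.
Qed.

End IID.

(** Some codebook is no worse than the average one. All penalties sit in one sum, since averaging
    selects a codebook for one quantity only. *)
Lemma random_coding {A} (supp : A -> Prop) (E : (A -> R) -> R) (d : A) (M : nat)
  (cost : A -> R) (pair : A -> A -> R) (c0 p0 : R) :
  expectation supp E -> E cost <= c0 -> (forall a, supp a -> E (pair a) <= p0) -> 0 <= p0 ->
  exists l : list A, length l = M /\ Forall supp l /\
    fsum M (fun j => cost (nth j l d) +
      fsum M (fun i => if Nat.eqb i j then 0 else pair (nth j l d) (nth i l d)))
    <= INR M * (c0 + INR M * p0).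
Proof.
  intros HE Hc Hp Hp0.
  pose proof (iid_expectation supp E HE M) as HM.
  destruct (exp_attained _ _ HM (fun l => fsum M (fun j => cost (nth j l d) +
      fsum M (fun i => if Nat.eqb i j then 0 else pair (nth j l d) (nth i l d))))
      (INR M * (c0 + INR M * p0))) as [l [[Hl Hs] H]]; [|exists l; auto].
  rewrite (exp_fsum _ _ HM), <- fsum_const; apply fsum_le; intros j Hj.
  rewrite (exp_add _ _ HM); apply Rplus_le_compat.
  - now rewrite (iid_nth supp E HE M j d cost Hj).
  - rewrite (exp_fsum _ _ HM), <- fsum_const; apply fsum_le; intros i Hi.
    destruct (Nat.eqb_spec i j).
    + now rewrite (exp_const _ _ HM).
    + now apply (iid_nth2_le supp E HE); auto.
Qed.

(** * Sums over output sequences *)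

Lemma seqsum_ext L n F G :
  (forall s, length s = n -> F s = G s) -> seqsum L n F = seqsum L n G.
Proof.
  revert F G; induction n as [|n IH]; intros F G H; simpl; [now apply H|].
  apply fsum_ext; intros y _; apply IH; intros s Hs; apply H; simpl; lia.
Qed.

Lemma seqsum_linear L n : linear_functional (seqsum L n).
Proof.
  split.
  - induction n as [|n IH]; intros F G; simpl; [reflexivity|].
    rewrite <- fsum_add; apply fsum_ext; intros; apply IH.
  - intros c; induction n as [|n IH]; intros F; simpl; [reflexivity|].
    rewrite <- fsum_scal; apply fsum_ext; intros; apply IH.
Qed.

Lemma seqsum_snoc L n F :
  seqsum L (S n) F = seqsum L n (fun s => fsum L (fun y => F (s ++ y :: nil))).
Proof.
  revert F; induction n as [|n IH]; intros F; [reflexivity|].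
  change (seqsum L (S (S n)) F) with (fsum L (fun y => seqsum L (S n) (fun s => F (y :: s)))).
  simpl seqsum at 2; apply fsum_ext; intros y _; now rewrite IH.
Qed.

Lemma firstn_snoc_le {A} i (l : list A) a :
  (i <= length l)%nat -> firstn i (l ++ a :: nil) = firstn i l.
Proof.
  intros H; rewrite firstn_app; replace (i - length l)%nat with 0%nat by lia.
  simpl; apply app_nil_r.
Qed.

Lemma chprob_snoc W1 W2 enc u j y1 y2 b1 b2 : length y1 = length y2 ->
  chprob W1 W2 enc u j (y1 ++ b1 :: nil) (y2 ++ b2 :: nil) =
  chprob W1 W2 enc u j y1 y2 * (W1 (enc u j y1 y2) b1 * W2 (enc u j y1 y2) b2).
Proof.
  intros Hl; unfold chprob; rewrite length_app, Nat.add_1_r; simpl; f_equal.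
  - apply fprod_ext; intros i Hi; cbv zeta.
    now rewrite !firstn_snoc_le, !app_nth1 by lia.
  - rewrite !firstn_snoc_le, firstn_all, (firstn_all2 y2), !app_nth2, Hl, !Nat.sub_diag by lia.
    reflexivity.
Qed.

Lemma combine_app {A B} (l1 l2 : list A) (m1 m2 : list B) : length l1 = length m1 ->
  combine (l1 ++ l2) (m1 ++ m2) = combine l1 m1 ++ combine l2 m2.
Proof.
  revert m1; induction l1 as [|a l1 IH]; intros [|b m1] H; simpl in *; try lia; [reflexivity|].
  now rewrite IH by lia.
Qed.

Lemma combine_app_long {A B} (l1 l2 : list A) (m : list B) :
  (length m <= length l1)%nat -> combine (l1 ++ l2) m = combine l1 m.
Proof.
  revert m; induction l1 as [|a l1 IH]; intros [|b m] H; simpl in *; try lia.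
  - now destruct l2.
  - reflexivity.
  - now rewrite IH by lia.
Qed.

Lemma combine_map_fst_snd {A B} (l : list (A * B)) :
  combine (map fst l) (map snd l) = l.
Proof. induction l as [|[a b] l IH]; simpl; [reflexivity|now rewrite IH]. Qed.

(** * Sums over lists, binary patterns and exponential inequalities *)

Definition lsum {A} (l : list A) (f : A -> R) : R := fold_right (fun a v => f a + v) 0 l.

Lemma lsum_nonneg {A} (l : list A) f : (forall a, 0 <= f a) -> 0 <= lsum l f.
Proof. intros H; induction l as [|a l IH]; simpl; [lra|pose proof (H a); lra]. Qed.

Lemma lsum_ge_term {A} (l : list A) f a : (forall a, 0 <= f a) -> In a l -> f a <= lsum l f.
Proof.
  intros H; induction l as [|b l IH]; simpl; intros Hin; [contradiction|].
  pose proof (lsum_nonneg l f H); pose proof (H b).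
  destruct Hin as [->|Hin]; [lra|apply IH in Hin; lra].
Qed.

Lemma lsum_le_const {A} (l : list A) f c :
  (forall a, f a <= c) -> lsum l f <= INR (length l) * c.
Proof.
  intros H; induction l as [|b l IH]; [simpl; lra|].
  change (length (b :: l)) with (S (length l)); rewrite S_INR; simpl.
  pose proof (H b); lra.
Qed.

Fixpoint bitlists (n : nat) : list (list bool) :=
  match n with
  | O => nil :: nil
  | S m => map (cons true) (bitlists m) ++ map (cons false) (bitlists m)
  end.

Lemma bitlists_complete s : In s (bitlists (length s)).
Proof.
  induction s as [|[] s IH]; simpl; [auto| |]; apply in_app_iff; [left|right];
    now apply in_map.
Qed.

Lemma bitlists_length n : INR (length (bitlists n)) = 2 ^ n.
Proof.
  induction n as [|n IH]; [reflexivity|].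
  simpl bitlists; rewrite length_app, !length_map, plus_INR, IH; simpl; lra.
Qed.

Definition Rleb (x y : R) : bool := if Rle_dec x y then true else false.

Lemma Rleb_true x y : Rleb x y = true <-> x <= y.
Proof. unfold Rleb; destruct (Rle_dec x y); split; auto; discriminate. Qed.

Lemma Rleb_false x y : Rleb x y = false <-> y < x.
Proof. unfold Rleb; destruct (Rle_dec x y); split; intros; try discriminate; auto; lra. Qed.

Lemma ind_le1 (b : bool) : (if b then 1 else 0) <= 1.
Proof. destruct b; lra. Qed.

(** From [exp (- z) >= 1 - z] follows [exp z <= 1 / (1 - z)], and [(1 + z + 2 z^2)(1 - z) = 1 + z^2
    (1 - 2 z) >= 1]. *)
Lemma exp_le_quadratic z : z <= 1 / 2 -> exp z <= 1 + z + 2 * z ^ 2.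
Proof.
  intros Hz; pose proof (exp_ineq1_le (- z)) as H; rewrite exp_Ropp in H.
  pose proof (exp_pos z) as Hp.
  assert (H1 : exp z * (1 + - z) <= 1).
  { apply Rle_trans with (exp z * / exp z); [now apply Rmult_le_compat_l; lra|].
    rewrite Rinv_r; lra. }
  assert (H2 : 0 <= z ^ 2 * (1 - 2 * z)) by (apply Rmult_le_pos; [apply pow2_ge_0|lra]).
  apply Rmult_le_reg_r with (1 + - z); [lra|]; nra.
Qed.

Lemma exp_le_compat x y : x <= y -> exp x <= exp y.
Proof. intros [H| ->]; [now apply Rlt_le, exp_increasing|apply Rle_refl]. Qed.

Lemma ln_le_compat x y : 0 < x -> x <= y -> ln x <= ln y.
Proof. intros Hx [H| ->]; [now apply Rlt_le, ln_increasing|apply Rle_refl]. Qed.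

Lemma exp_moment {A} (supp : A -> Prop) E (HE : expectation supp E) (X : A -> R) c th :
  (forall a, supp a -> Rabs (X a) <= c) -> Rabs th * c <= 1 / 2 ->
  E (fun a => exp (th * X a)) <= exp (th * E X + 2 * th ^ 2 * c ^ 2).
Proof.
  intros HX Hth.
  apply Rle_trans with (E (fun a => (1 + 2 * th ^ 2 * c ^ 2) + th * X a)).
  - apply (exp_mono _ _ HE); intros a Ha.
    assert (Habs : Rabs (th * X a) <= 1 / 2).
    { rewrite Rabs_mult; eapply Rle_trans; [|exact Hth].
      apply Rmult_le_compat_l; [apply Rabs_pos|auto]. }
    assert (Hsq : (th * X a) ^ 2 <= th ^ 2 * c ^ 2).
    { rewrite Rpow_mult_distr; apply Rmult_le_compat_l; [apply pow2_ge_0|].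
      rewrite <- (pow2_abs (X a)); apply pow_incr; split; [apply Rabs_pos|auto]. }
    eapply Rle_trans; [apply exp_le_quadratic|lra].
    eapply Rle_trans; [apply Rle_abs|exact Habs].
  - rewrite (exp_add _ _ HE), (exp_const _ _ HE), (exp_scal _ _ HE).
    eapply Rle_trans; [|apply exp_ineq1_le]; lra.
Qed.

Lemma distr_pos_dim n p : distr n p -> (0 < n)%nat.
Proof. intros [_ H]; destruct n; [simpl in H; lra|lia]. Qed.

(** * The coding scheme *)

(* Receivers are indexed by booleans: [true] is receiver 1 and [false] receiver 2.
   Every codeword letter is a pair of channel inputs, drawn from [P false] and [P true];
   the encoder transmits one of the two components, and switches between them only at
   multiples of [B]. *)
Section Scheme.

Variables (N L : nat) (W : bool -> nat -> nat -> R) (P : bool -> nat -> R).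
Hypothesis HW : forall k, stoch N L (W k).
Hypothesis HP : forall s, distr N (P s).
Variables (B : nat) (gam : R).
Hypothesis HB : (0 < B)%nat.

Definition ratio (k s : bool) (x y : nat) : R := W k x y / outd N (P s) (W k) y.

Definition sel (s : bool) (p : nat * nat) : nat := if s then snd p else fst p.

Definition letter (F : nat * nat -> R) : R :=
  wsum N (P false) (fun x0 => wsum N (P true) (fun x1 => F (x0, x1))).

Definition chan (x : nat) (F : nat * nat -> R) : R :=
  wsum L (W true x) (fun b1 => wsum L (W false x) (fun b2 => F (b1, b2))).

Definition stepE (s : bool) (F : (nat * nat) * (nat * nat) -> R) : R :=
  letter (fun p => chan (sel s p) (fun b => F (p, b))).

Definition letter_supp (p : nat * nat) : Prop := (fst p < N)%nat /\ (snd p < N)%nat.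

Definition proj (k : bool) (b : nat * nat) : nat := if k then fst b else snd b.

Definition chan_supp (x : nat) (b : nat * nat) : Prop :=
  forall k, (proj k b < L)%nat /\ 0 < W k x (proj k b).

Definition step_supp (s : bool) (w : (nat * nat) * (nat * nat)) : Prop :=
  letter_supp (fst w) /\ chan_supp (sel s (fst w)) (snd w).

Lemma letter_expectation : expectation letter_supp letter.
Proof.
  apply (expectation_bind _ _ _ (fun _ => wsum N (P true)) _ _
    (wsum_expectation N _ (HP false)) (fun _ _ => wsum_expectation N _ (HP true))).
  intros a b [Ha _] [Hb _]; split; assumption.
Qed.

Lemma chan_expectation x : (x < N)%nat -> expectation (chan_supp x) (chan x).
Proof.
  intros Hx.
  apply (expectation_bind _ _ _ (fun _ => wsum L (W false x)) _ _
    (wsum_expectation L _ (HW true x Hx)) (fun _ _ => wsum_expectation L _ (HW false x Hx))).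
  intros a b Ha Hb []; assumption.
Qed.

Lemma sel_lt s p : letter_supp p -> (sel s p < N)%nat.
Proof. intros [H1 H2]; destruct s; assumption. Qed.

Lemma stepE_expectation s : expectation (step_supp s) (stepE s).
Proof.
  apply (expectation_bind _ _ (fun p => chan_supp (sel s p)) (fun p => chan (sel s p))
    (fun p b => (p, b)) _ letter_expectation).
  - intros p Hp; apply chan_expectation, sel_lt, Hp.
  - intros p b Hp Hb; split; assumption.
Qed.

Lemma letter_sel s (f : nat -> R) : letter (fun p => f (sel s p)) = wsum N (P s) f.
Proof.
  unfold letter; destruct s; simpl.
  - apply (exp_const _ _ (wsum_expectation N _ (HP false))).
  - f_equal; apply functional_extensionality; intros x.
    apply (exp_const _ _ (wsum_expectation N _ (HP true))).
Qed.

(** Change of measure for a letter independent of the output: the mean is 1, or 0 when [y] has no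
    mass. *)
Lemma letter_ratio_le1 k s y : letter (fun p => ratio k s (sel s p) y) <= 1.
Proof.
  rewrite (letter_sel s (fun x => ratio k s x y)); unfold wsum, ratio.
  rewrite (fsum_ext N _ (fun x => / outd N (P s) (W k) y * (P s x * W k x y)))
    by (intros; unfold Rdiv; ring).
  rewrite fsum_scal; change (fsum N (fun x => P s x * W k x y)) with (outd N (P s) (W k) y).
  destruct (Req_dec (outd N (P s) (W k) y) 0) as [->|H]; [lra|].
  rewrite Rinv_l by assumption; lra.
Qed.

Lemma outd_nonneg s k y : (y < L)%nat -> 0 <= outd N (P s) (W k) y.
Proof.
  intros Hy; apply fsum_nonneg; intros x Hx; apply Rmult_le_pos.
  - now apply (HP s).
  - now apply (HW k x Hx).
Qed.

Lemma outd_pos s k x y : (x < N)%nat -> (y < L)%nat -> 0 < P s x -> 0 < W k x y ->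
  0 < outd N (P s) (W k) y.
Proof.
  intros Hx Hy H1 H2; apply Rlt_le_trans with (P s x * W k x y); [now apply Rmult_lt_0_compat|].
  apply (fsum_ge_term N (fun x => P s x * W k x y)); [|assumption].
  intros i Hi; apply Rmult_le_pos; [now apply (HP s)|now apply (HW k i Hi)].
Qed.

Lemma ratio_nonneg k s x y : (x < N)%nat -> (y < L)%nat -> 0 <= ratio k s x y.
Proof.
  intros Hx Hy; unfold ratio; pose proof (outd_nonneg s k y Hy) as Ho.
  destruct (Req_dec (outd N (P s) (W k) y) 0) as [->|H].
  - unfold Rdiv; rewrite Rinv_0; lra.
  - apply Rmult_le_pos; [now apply (HW k x Hx)|].
    apply Rlt_le, Rinv_0_lt_compat; lra.
Qed.

(** * The encoder's state and the laws it induces *)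

Record state := State { tm : nat; sg : list bool; lr : bool -> R }.

Definition cur (q : state) : bool := nth (tm q / B) (sg q) false.

Definition init : state := State 0 (false :: nil) (fun _ => 1).

Definition done (q : state) : bool :=
  Rleb (exp gam) (lr q true) && Rleb (exp gam) (lr q false).

(* The state is frozen once both receivers have reached the threshold. At a block
   boundary the next block favours the receiver with the smaller likelihood ratio. *)
Definition step (q : state) (w : (nat * nat) * (nat * nat)) : state :=
  if done q then q else
  let s := cur q in
  let r := fun k => lr q k * ratio k s (sel s (fst w)) (proj k (snd w)) in
  State (S (tm q))
    (if Nat.eqb (S (tm q) mod B) 0 then sg q ++ Rleb (r false) (r true) :: nil else sg q) r.

Definition run (a y : list (nat * nat)) : state := fold_left step (combine a y) init.

(** Feedback lets the encoder replay the state. The final test keeps the value below [N] for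
    arbitrary arguments, as the code definition demands; letters drawn from [letter] always pass
    it. *)
Definition encoder (a y : list (nat * nat)) : nat :=
  let x := sel (cur (run a y)) (nth (length y) a (0, 0)%nat) in
  if Nat.ltb x N then x else 0%nat.

(** Law of the first [n] output pairs for a fixed codeword; [chain] is the law of the state with the
    codeword averaged out. *)
Fixpoint path (a : list (nat * nat)) (n : nat) (F : list (nat * nat) -> R) : R :=
  match n with
  | O => F nil
  | S m => path a m (fun y => chan (encoder a y) (fun b => F (y ++ b :: nil)))
  end.

Fixpoint chain (n : nat) (F : state -> R) : R :=
  match n with
  | O => F init
  | S m => chain m (fun q => stepE (cur q) (fun w => F (step q w)))
  end.

Lemma chain_expectation (inv : state -> Prop) n : inv init ->
  (forall q w, inv q -> step_supp (cur q) w -> inv (step q w)) -> expectation inv (chain n).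
Proof.
  intros H0 HS; induction n as [|n IH]; simpl; [now apply dirac_expectation|].
  apply (expectation_bind _ _ (fun q => step_supp (cur q)) (fun q => stepE (cur q)) step _ IH);
    [|assumption].
  intros q _; apply stepE_expectation.
Qed.

Lemma encoder_lt a y : (encoder a y < N)%nat.
Proof.
  unfold encoder; destruct (Nat.ltb_spec (sel (cur (run a y)) (nth (length y) a (0, 0)%nat)) N);
    [assumption|apply (distr_pos_dim N _ (HP true))].
Qed.

Definition path_supp (n : nat) (y : list (nat * nat)) : Prop :=
  length y = n /\ forall k, Forall (fun b => (proj k b < L)%nat) y.

Lemma path_expectation a n : expectation (path_supp n) (path a n).
Proof.
  induction n as [|n IH]; simpl.
  - apply dirac_expectation; split; [reflexivity|constructor].
  - apply (expectation_bind _ _ (fun y => chan_supp (encoder a y))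
      (fun y => chan (encoder a y)) (fun y b => y ++ b :: nil) _ IH).
    + intros y _; apply chan_expectation, encoder_lt.
    + intros y b [Hl Hf] Hb; split; [rewrite length_app; simpl; lia|].
      intros k; apply Forall_app; split; [apply Hf|].
      constructor; [apply Hb|constructor].
Qed.

Lemma run_snoc a y p b : length a = length y ->
  run (a ++ p :: nil) (y ++ b :: nil) = step (run a y) (p, b).
Proof. intros H; unfold run; now rewrite combine_app, fold_left_app by assumption. Qed.

Lemma run_app a a' y : (length y <= length a)%nat -> run (a ++ a') y = run a y.
Proof. intros H; unfold run; now rewrite combine_app_long. Qed.

Lemma encoder_app a a' y : (length y < length a)%nat -> encoder (a ++ a') y = encoder a y.
Proof. intros H; unfold encoder; now rewrite run_app, app_nth1 by lia. Qed.

Lemma path_app a a' n F : (n <= length a)%nat -> path (a ++ a') n F = path a n F.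
Proof.
  revert F; induction n as [|n IH]; intros F H; simpl; [reflexivity|].
  rewrite IH by lia; apply (exp_ext _ _ (path_expectation a n)); intros y [Hy _].
  now rewrite encoder_app by lia.
Qed.

(** The letter at index [n] is first read after [n] outputs, so its average commutes with their law.
    Averaged over the codeword, the state thus becomes a Markov chain with fresh letters. *)
Lemma chain_of_path n F :
  iid letter n (fun a => path a n (fun y => F (run a y))) = chain n F.
Proof.
  revert F; induction n as [|n IH]; intros F; [reflexivity|]; simpl.
  rewrite <- IH; apply (exp_ext _ _ (iid_expectation _ _ letter_expectation n)).
  intros a [Ha _].
  transitivity (letter (fun p => path a n (fun y =>
    chan (sel (cur (run a y)) p) (fun b => F (step (run a y) (p, b)))))).
  - apply (exp_ext _ _ letter_expectation); intros p Hp.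
    rewrite path_app by lia; apply (exp_ext _ _ (path_expectation a n)); intros y [Hy _].
    replace (encoder (a ++ p :: nil) y) with (sel (cur (run a y)) p).
    + f_equal; apply functional_extensionality; intros b; now rewrite run_snoc by lia.
    + unfold encoder; rewrite run_app, app_nth2 by lia.
      replace (length y - length a)%nat with 0%nat by lia; simpl nth.
      now rewrite (proj2 (Nat.ltb_lt _ _) (sel_lt (cur (run a y)) p Hp)).
  - symmetry; apply (exp_comm _ _ letter_expectation _ _ (exp_linear _ _ (path_expectation a n))).
Qed.

Lemma chain_of_long_path n T F : (n <= T)%nat ->
  iid letter T (fun a => path a n (fun y => F (run a y))) = chain n F.
Proof.
  intros H; rewrite <- chain_of_path, <- (iid_firstn _ _ letter_expectation n T) by assumption.
  apply (exp_ext _ _ (iid_expectation _ _ letter_expectation T)); intros a [Ha _].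
  rewrite <- (firstn_skipn n a) at 1; rewrite path_app by (rewrite length_firstn; lia).
  apply (exp_ext _ _ (path_expectation _ n)); intros y [Hy _].
  rewrite <- (firstn_skipn n a) at 1; now rewrite run_app by (rewrite length_firstn; lia).
Qed.

(** Bridge from the code definition to [path]. The definition sums over the two output sequences
    separately, hence the exchange of sums when the last pair is peeled off. *)
Lemma seqsum_chprob_path a enc u j n (F : list nat -> list nat -> R) :
  (forall y1 y2, enc u j y1 y2 = encoder a (combine y1 y2)) ->
  seqsum L n (fun y1 => seqsum L n (fun y2 =>
    chprob (W true) (W false) enc u j y1 y2 * F y1 y2))
  = path a n (fun y => F (map fst y) (map snd y)).
Proof.
  intros He; revert F; induction n as [|n IH]; intros F.
  - simpl; unfold chprob; simpl; ring.
  - rewrite seqsum_snoc; simpl path.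
    transitivity (seqsum L n (fun y1 => seqsum L n (fun y2 =>
      chprob (W true) (W false) enc u j y1 y2 *
      chan (encoder a (combine y1 y2)) (fun b => F (y1 ++ fst b :: nil) (y2 ++ snd b :: nil))))).
    + apply seqsum_ext; intros y1 H1.
      rewrite <- (linear_fsum _ (seqsum_linear L (S n))), seqsum_snoc.
      apply seqsum_ext; intros y2 H2.
      rewrite fsum_swap; unfold chan, wsum; rewrite <- fsum_scal.
      apply fsum_ext; intros b1 _; rewrite <- !fsum_scal; apply fsum_ext; intros b2 _.
      rewrite chprob_snoc, He by congruence; simpl; ring.
    + rewrite (IH (fun y1 y2 => chan (encoder a (combine y1 y2))
        (fun b => F (y1 ++ fst b :: nil) (y2 ++ snd b :: nil)))).
      f_equal; apply functional_extensionality; intros y.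
      rewrite combine_map_fst_snd; f_equal; apply functional_extensionality; intros b.
      now rewrite !map_app.
Qed.

(** Likelihood ratio under hypothetical switches [s]. It reads the outputs of receiver [k] only, so
    that receiver can evaluate it for every [s]. *)
Definition score (k : bool) (s : list bool) (a : list (nat * nat)) (y : list nat) : R :=
  fprod (length y) (fun i =>
    let b := nth (i / B) s false in ratio k b (sel b (nth i a (0, 0)%nat)) (nth i y 0%nat)).

Lemma score_snoc k s a y z :
  score k s a (y ++ z :: nil) =
  score k s a y * (let b := nth (length y / B) s false in
    ratio k b (sel b (nth (length y) a (0, 0)%nat)) z).
Proof.
  unfold score; rewrite length_app, Nat.add_1_r; simpl; f_equal.
  - apply fprod_ext; intros i Hi; now rewrite app_nth1.
  - now rewrite app_nth2, Nat.sub_diag by lia.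
Qed.

Lemma score_app k s s' a y : (forall i, (i < length y)%nat -> (i / B < length s)%nat) ->
  score k (s ++ s') a y = score k s a y.
Proof.
  intros H; apply fprod_ext; intros i Hi; cbv zeta; now rewrite app_nth1 by auto.
Qed.

Lemma score_app_word k s a a' y : (length y <= length a)%nat ->
  score k s (a ++ a') y = score k s a y.
Proof.
  intros H; apply fprod_ext; intros i Hi; cbv zeta; now rewrite app_nth1 by lia.
Qed.

Lemma iid_fprod_le1 {A} (supp : A -> Prop) E (HE : expectation supp E) d n (f : nat -> A -> R) :
  (forall i, (i < n)%nat -> E (f i) <= 1) ->
  (forall i a, (i < n)%nat -> supp a -> 0 <= f i a) ->
  iid E n (fun l => fprod n (fun i => f i (nth i l d))) <= 1.
Proof.
  induction n as [|n IH]; intros H1 H0; simpl; [lra|].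
  apply Rle_trans with (iid E n (fun l => fprod n (fun i => f i (nth i l d))));
    [|apply IH; intros; [apply H1|apply H0]; auto; lia].
  apply (exp_mono _ _ (iid_expectation _ _ HE n)); intros l [Hl Hs].
  assert (Hpos : 0 <= fprod n (fun i => f i (nth i l d))).
  { apply fprod_nonneg; intros i Hi; apply H0; [lia|].
    rewrite Forall_forall in Hs; apply Hs, nth_In; lia. }
  rewrite (exp_ext _ _ HE _ (fun a => fprod n (fun i => f i (nth i l d)) * f n a)).
  - rewrite (exp_scal _ _ HE); pose proof (H1 n (Nat.lt_succ_diag_r n)); nra.
  - intros a _; f_equal; [|now rewrite app_nth2, Hl, Nat.sub_diag by lia].
    apply fprod_ext; intros i Hi; now rewrite app_nth1 by lia.
Qed.

(** The letterwise change of measure, multiplied over independent letters. By Markov's inequality a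
    false crossing of [exp gam] then has probability at most [exp (- gam)]. *)
Lemma score_expectation_le1 k s T y : (length y <= T)%nat -> Forall (fun b => (b < L)%nat) y ->
  iid letter T (fun a => score k s a y) <= 1.
Proof.
  intros HT Hy.
  apply Rle_trans with (iid letter T (fun a => score k s (firstn (length y) a) y)).
  { apply Req_le, (exp_ext _ _ (iid_expectation _ _ letter_expectation T)); intros a [Ha _].
    rewrite <- (firstn_skipn (length y) a) at 1.
    now rewrite score_app_word by (rewrite length_firstn; lia). }
  rewrite (iid_firstn _ _ letter_expectation _ _ (fun a => score k s a y)) by assumption.
  unfold score.
  apply (iid_fprod_le1 _ _ letter_expectation (0, 0)%nat (length y)
    (fun i p => ratio k (nth (i / B) s false) (sel (nth (i / B) s false) p) (nth i y 0%nat))).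
  - intros i _; apply letter_ratio_le1.
  - intros i p Hi Hp; apply ratio_nonneg; [now apply sel_lt|].
    rewrite Forall_forall in Hy; now apply Hy, nth_In.
Qed.

Lemma next_not_boundary t : (S t mod B <> 0)%nat ->
  (S t / B = t / B /\ S t mod B = S (t mod B))%nat.
Proof.
  intros H.
  pose proof (Nat.div_mod_eq t B); pose proof (Nat.mod_upper_bound t B ltac:(lia)).
  destruct (Nat.eq_dec (S (t mod B)) B) as [E|E].
  - exfalso; apply H; replace (S t) with ((t / B + 1) * B)%nat by nia.
    apply Nat.Div0.mod_mul.
  - assert (S (t mod B) < B)%nat by lia.
    split; symmetry; [apply (Nat.div_unique _ B _ (S (t mod B)))
      |apply (Nat.mod_unique _ B (t / B))]; lia.
Qed.

Lemma next_boundary t : (S t mod B = 0)%nat ->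
  (S t / B = t / B + 1 /\ S (t mod B) = B)%nat.
Proof.
  intros H.
  pose proof (Nat.div_mod_eq t B); pose proof (Nat.mod_upper_bound t B ltac:(lia)).
  pose proof (Nat.div_mod_eq (S t) B) as E; rewrite H in E.
  destruct (Nat.lt_trichotomy (S t / B) (t / B + 1)) as [X|[X|X]]; nia.
Qed.

Definition state_wf (q : state) : Prop := length (sg q) = (tm q / B + 1)%nat.

Lemma init_wf : state_wf init.
Proof. unfold state_wf; simpl; now rewrite Nat.Div0.div_0_l. Qed.

Lemma step_wf q w : state_wf q -> state_wf (step q w).
Proof.
  unfold state_wf, step; intros H; destruct (done q); [assumption|]; cbn [tm sg].
  destruct (Nat.eqb_spec (S (tm q) mod B) 0) as [E|E].
  - destruct (next_boundary _ E); rewrite length_app; simpl; lia.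
  - destruct (next_not_boundary _ E); lia.
Qed.

(** The encoder's likelihood ratios are the scores for the switches really made, read at the clock
    [tm], which halts when the state freezes. This links the decoders' search over patterns to the
    actual run. *)
Lemma run_score a y : (length y <= length a)%nat ->
  let q := run a y in
  (tm q <= length y)%nat /\ state_wf q /\
  (forall k, lr q k = score k (sg q) a (map (proj k) (firstn (tm q) y))) /\
  (done q = true \/ tm q = length y).
Proof.
  induction y as [|b y IH] using rev_ind; intros Hl.
  - unfold run; rewrite combine_nil; simpl; repeat split; auto using init_wf.
  - rewrite length_app in Hl; simpl in Hl.
    destruct IH as (H1 & H2 & H3 & H4); [lia|].
    assert (Hr : run a (y ++ b :: nil) = step (run a y) (nth (length y) a (0, 0)%nat, b)).
    { rewrite <- (firstn_skipn (length y) a) at 1.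
      destruct (skipn (length y) a) as [|p l] eqn:Es.
      { pose proof (length_skipn (length y) a) as E; rewrite Es in E; simpl in E; lia. }
      change (p :: l) with ((p :: nil) ++ l); rewrite app_assoc, run_app
        by (rewrite !length_app, length_firstn; simpl; lia).
      rewrite run_snoc by (rewrite length_firstn; lia).
      f_equal.
      - rewrite <- (firstn_skipn (length y) a) at 2; rewrite run_app; [reflexivity|].
        rewrite length_firstn; lia.
      - f_equal; rewrite <- (firstn_skipn (length y) a), Es, app_nth2
          by (rewrite length_firstn; lia).
        rewrite length_firstn; replace (length y - _)%nat with 0%nat by lia; reflexivity. }
    cbv zeta; rewrite Hr; pose proof (step_wf _ (nth (length y) a (0, 0)%nat, b) H2) as Hwf.
    unfold step in *; destruct (done (run a y)) eqn:Hd.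
    + repeat split; auto; [rewrite length_app; simpl; lia|].
      intros k; rewrite H3, firstn_snoc_le by lia; reflexivity.
    + destruct H4 as [H4|H4]; [discriminate|].
      assert (Hs : forall k, lr (run a y) k * ratio k (cur (run a y))
          (sel (cur (run a y)) (nth (length y) a (0, 0)%nat)) (proj k b)
        = score k (sg (run a y)) a (map (proj k) (y ++ b :: nil))).
      { intros k; rewrite map_app; simpl map; rewrite score_snoc, length_map.
        unfold cur; rewrite H3, H4, firstn_all; reflexivity. }
      cbn [tm sg lr fst snd] in *.
      repeat split; auto; [rewrite length_app; simpl; lia| |right; rewrite length_app; simpl; lia].
      intros k; rewrite Hs, firstn_all2 by (rewrite length_app; simpl; lia).
      destruct (Nat.eqb (S (tm (run a y)) mod B) 0); [|reflexivity].
      (* A sign appended at a boundary governs the next block only, so the score up to now does not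
         see it. *)
      symmetry; apply score_app; intros i Hi; rewrite length_map, length_app in Hi; simpl in Hi.
      rewrite H2, H4; assert (i / B <= length y / B)%nat by (apply Nat.Div0.div_le_mono; lia); lia.
Qed.

(** * Stopping and decoding rules, and the events they cause *)

Section Code.

Variables (T M : nat) (cb : list (list (nat * nat))).

(** The length [sg] has when the clock reads [T], counting a block that may start right then. *)
Definition nblocks : nat := (T / B + 1)%nat.

Definition crosses (k : bool) (a : list (nat * nat)) (y : list nat) : bool :=
  existsb (fun s => Rleb (exp gam) (score k s a y)) (bitlists nblocks).

Definition crossing (k : bool) (y : list nat) : bool :=
  existsb (fun j => crosses k (nth j cb nil) y) (seq 0 M).

(** [u = 0] means giving up at time 0. Otherwise a crossing by any codeword stops the receiver, with
    a cap at [T], where the codewords end. *)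
Definition stop_rule (k : bool) (u : nat) (y : list nat) : bool :=
  Nat.eqb u 0 || (Nat.leb T (length y) || crossing k y).

Definition dec_rule (k : bool) (u : nat) (y : list nat) : nat :=
  match find (fun j => crosses k (nth j cb nil) y) (seq 0 M) with
  | Some j => j
  | None => 0%nat
  end.

Definition enc_rule (u j : nat) (y1 y2 : list nat) : nat :=
  encoder (nth j cb nil) (combine y1 y2).

Definition undone (q : state) : R := if done q then 0 else 1.

(** Dominates the indicator of [crosses]: Markov's inequality and the union over patterns in one
    linear quantity. *)
Definition pseudo_score (k : bool) (a : list (nat * nat)) (y : list nat) : R :=
  lsum (bitlists nblocks) (fun s => exp (- gam) * score k s a y).

Definition mean_time (a : list (nat * nat)) : R :=
  fsum T (fun n => path a n (fun y => undone (run a y))).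

Definition late (a : list (nat * nat)) : R := path a T (fun y => undone (run a y)).

Definition confusion (k : bool) (a a' : list (nat * nat)) : R :=
  fsum (S T) (fun n => path a n (fun y => pseudo_score k a' (map (proj k) y))).

Lemma undone_nonneg q : 0 <= undone q.
Proof. unfold undone; destruct (done q); lra. Qed.

Lemma score_nonneg k s a y : Forall letter_supp a -> (length y <= length a)%nat ->
  Forall (fun b => (b < L)%nat) y -> 0 <= score k s a y.
Proof.
  intros Ha Hl Hy; apply fprod_nonneg; intros i Hi; rewrite Forall_forall in Ha, Hy.
  apply ratio_nonneg; [apply sel_lt, Ha, nth_In; lia|now apply Hy, nth_In].
Qed.

Lemma pseudo_score_nonneg k a y : Forall letter_supp a -> (length y <= length a)%nat ->
  Forall (fun b => (b < L)%nat) y -> 0 <= pseudo_score k a y.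
Proof.
  intros; apply lsum_nonneg; intros s.
  apply Rmult_le_pos; [apply Rlt_le, exp_pos|now apply score_nonneg].
Qed.

Lemma pseudo_score_crosses k a y : Forall letter_supp a -> (length y <= length a)%nat ->
  Forall (fun b => (b < L)%nat) y -> crosses k a y = true -> 1 <= pseudo_score k a y.
Proof.
  intros Ha Hl Hy Hc; apply existsb_exists in Hc; destruct Hc as [s [Hs Hc]].
  apply Rleb_true in Hc.
  apply Rle_trans with (exp (- gam) * score k s a y).
  - rewrite exp_Ropp; pose proof (exp_pos gam).
    apply Rmult_le_reg_l with (exp gam); [assumption|].
    rewrite <- Rmult_assoc, Rinv_r by lra; lra.
  - apply (lsum_ge_term _ (fun s => exp (- gam) * score k s a y)); [|assumption].
    intros t; apply Rmult_le_pos; [apply Rlt_le, exp_pos|now apply score_nonneg].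
Qed.

Lemma run_done_crosses a y : (length y <= T)%nat -> (length y <= length a)%nat ->
  done (run a y) = true ->
  exists m, (m <= length y)%nat /\ forall k, crosses k a (map (proj k) (firstn m y)) = true.
Proof.
  intros HT Ha Hd; destruct (run_score a y Ha) as (H1 & H2 & H3 & _).
  exists (tm (run a y)); split; [assumption|]; intros k.
  set (q := run a y) in *.
  assert (Hlen : (length (sg q) <= nblocks)%nat).
  { unfold state_wf in H2; unfold nblocks; rewrite H2.
    assert (tm q / B <= T / B)%nat by (apply Nat.Div0.div_le_mono; lia); lia. }
  (* The pattern in use may be shorter than [nblocks]; the padding concerns later blocks and leaves
     the score unchanged. *)
  apply existsb_exists; exists (sg q ++ repeat false (nblocks - length (sg q))); split.
  - replace nblocks with (length (sg q ++ repeat false (nblocks - length (sg q)))) at 2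
      by (rewrite length_app, repeat_length; lia).
    apply bitlists_complete.
  - apply Rleb_true; rewrite score_app.
    + rewrite <- H3; unfold done in Hd; apply andb_prop in Hd.
      destruct k; now apply Rleb_true.
    + intros i Hi; rewrite length_map, length_firstn in Hi; rewrite H2.
      assert (i / B <= tm q / B)%nat by (apply Nat.Div0.div_le_mono; lia); lia.
Qed.

Lemma stopped_by_intro stop u y n m :
  (m <= n)%nat -> stop u (firstn m y) = true -> stopped_by stop u y n = true.
Proof.
  intros Hm H; apply existsb_exists; exists m; split; [apply in_seq; lia|assumption].
Qed.

Lemma stops_at_inv stop u y n : length y = n -> stops_at stop u y n = true ->
  stop u y = true /\ forall m, (m < n)%nat -> stop u (firstn m y) = false.
Proof.
  intros Hn H; apply andb_prop in H; destruct H as [H1 H2]; split.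
  - now rewrite <- Hn, firstn_all in H1.
  - intros m Hm; rewrite forallb_forall in H2; apply negb_true_iff, H2, in_seq; lia.
Qed.

Hypothesis Hcb : Forall (fun a => length a = T /\ Forall letter_supp a) cb.
Hypothesis HM : length cb = M.

Lemma word_spec j : (j < M)%nat ->
  length (nth j cb nil) = T /\ Forall letter_supp (nth j cb nil).
Proof. intros Hj; rewrite Forall_forall in Hcb; apply Hcb, nth_In; lia. Qed.

Lemma done_stops j y k : (j < M)%nat -> (length y <= T)%nat ->
  done (run (nth j cb nil) y) = true ->
  exists m, (m <= length y)%nat /\ crossing k (map (proj k) (firstn m y)) = true.
Proof.
  intros Hj HT Hd; destruct (word_spec j Hj) as [Hl _].
  destruct (run_done_crosses (nth j cb nil) y) as [m [Hm Hc]]; try lia; [assumption|].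
  exists m; split; [assumption|]; apply existsb_exists; exists j; split; [apply in_seq; lia|auto].
Qed.

(** A false crossing can only make a receiver stop sooner, so the run of the sent word bounds the
    time. *)
Lemma time_event_le j y n : (j < M)%nat -> length y = n ->
  (if negb (stopped_by (stop_rule true) 1 (map fst y) n &&
            stopped_by (stop_rule false) 1 (map snd y) n) then 1 else 0)
  <= if Nat.ltb n T then undone (run (nth j cb nil) y) else 0.
Proof.
  intros Hj Hn.
  assert (Hs : forall k m, (m <= n)%nat ->
    Nat.leb T m || crossing k (map (proj k) (firstn m y)) = true ->
    stopped_by (stop_rule k) 1 (map (proj k) y) n = true).
  { intros k m Hm H; apply (stopped_by_intro _ _ _ _ m Hm); unfold stop_rule; simpl Nat.eqb.
    rewrite firstn_map, length_map, length_firstn, Nat.min_l by lia; exact H. }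
  change (map fst y) with (map (proj true) y); change (map snd y) with (map (proj false) y).
  destruct (Nat.ltb_spec n T) as [HT|HT].
  - unfold undone; destruct (done (run (nth j cb nil) y)) eqn:Hd; [|apply ind_le1].
    assert (Hk : forall k, stopped_by (stop_rule k) 1 (map (proj k) y) n = true).
    { intros k; destruct (done_stops j y k Hj ltac:(lia) Hd) as [m [Hm Hc]].
      apply (Hs k m); [lia|]; rewrite Hc; apply orb_true_r. }
    rewrite !Hk; simpl; lra.
  - assert (Hk : forall k, stopped_by (stop_rule k) 1 (map (proj k) y) n = true).
    { intros k; apply (Hs k T); [assumption|]; now rewrite Nat.leb_refl. }
    rewrite !Hk; simpl; lra.
Qed.

(** A wrong decision has two causes: a competitor crosses at this very time, or the cap [T] is
    reached without any crossing, which forces the sent word's run to be unfinished. *)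
Lemma error_event_le k j y n : (j < M)%nat -> path_supp n y ->
  (if stops_at (stop_rule k) 1 (map (proj k) y) n &&
      negb (Nat.eqb (dec_rule k 1 (map (proj k) y)) j) then 1 else 0)
  <= if Nat.ltb n (S T) then
       fsum M (fun i => if Nat.eqb i j then 0
                        else pseudo_score k (nth i cb nil) (map (proj k) y))
       + (if Nat.eqb n T then undone (run (nth j cb nil) y) else 0)
     else 0.
Proof.
  intros Hj [Hn Hy].
  destruct (stops_at (stop_rule k) 1 (map (proj k) y) n) eqn:Hs.
  2:{ simpl; destruct (Nat.ltb_spec n (S T)); [|lra].
      assert (0 <= fsum M (fun i => if Nat.eqb i j then 0
                        else pseudo_score k (nth i cb nil) (map (proj k) y))).
      { apply fsum_nonneg; intros i Hi; destruct (Nat.eqb i j); [lra|].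
        destruct (word_spec i Hi); apply pseudo_score_nonneg; auto.
        - rewrite length_map; lia.
        - apply Forall_map; apply Hy. }
      destruct (Nat.eqb n T); [|lra].
      pose proof (undone_nonneg (run (nth j cb nil) y)); lra. }
  apply stops_at_inv in Hs; [|now rewrite length_map]; destruct Hs as [Hs1 Hs2].
  assert (HnT : (n <= T)%nat).
  { destruct (Nat.le_gt_cases n T) as [|H]; [assumption|exfalso].
    specialize (Hs2 T H); unfold stop_rule in Hs2; simpl Nat.eqb in Hs2.
    rewrite firstn_map, length_map, length_firstn, Nat.min_l, Nat.leb_refl in Hs2 by lia.
    discriminate. }
  rewrite (proj2 (Nat.ltb_lt n (S T))) by lia.
  assert (Hps : forall i, (i < M)%nat -> 0 <= pseudo_score k (nth i cb nil) (map (proj k) y)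
    /\ (crosses k (nth i cb nil) (map (proj k) y) = true ->
        1 <= pseudo_score k (nth i cb nil) (map (proj k) y))).
  { intros i Hi; destruct (word_spec i Hi).
    assert (length (map (proj k) y) <= length (nth i cb nil))%nat by (rewrite length_map; lia).
    assert (Forall (fun b => (b < L)%nat) (map (proj k) y)) by (apply Forall_map; apply Hy).
    split; [now apply pseudo_score_nonneg|now apply pseudo_score_crosses]. }
  assert (Hnn : forall i, (i < M)%nat -> 0 <= (fun i => if Nat.eqb i j then 0
                        else pseudo_score k (nth i cb nil) (map (proj k) y)) i).
  { intros i Hi; cbv beta; destruct (Nat.eqb i j); [lra|now apply Hps]. }
  assert (Hun : 0 <= if Nat.eqb n T then undone (run (nth j cb nil) y) else 0).
  { destruct (Nat.eqb n T); [apply undone_nonneg|lra]. }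
  unfold dec_rule.
  destruct (find (fun j => crosses k (nth j cb nil) (map (proj k) y)) (seq 0 M))
    as [i|] eqn:Hf.
  - apply find_some in Hf; destruct Hf as [Hi Hc]; apply in_seq in Hi.
    simpl andb; destruct (Nat.eqb i j) eqn:Hij; simpl.
    + pose proof (fsum_nonneg M _ Hnn) as Hx; cbv beta in Hx; lra.
    + pose proof (fsum_ge_term M _ i Hnn ltac:(lia)) as Hx; cbv beta in Hx; rewrite Hij in Hx.
      pose proof (proj2 (Hps i ltac:(lia)) Hc); lra.
  - assert (Hnc : crossing k (map (proj k) y) = false).
    { apply not_true_iff_false; intros H; apply existsb_exists in H.
      destruct H as [i [Hi Hc]]; now rewrite (find_none _ _ Hf i Hi) in Hc. }
    assert (HT : n = T).
    { unfold stop_rule in Hs1; simpl Nat.eqb in Hs1; rewrite Hnc, orb_false_r in Hs1.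
      simpl in Hs1; apply Nat.leb_le in Hs1; rewrite length_map in Hs1; lia. }
    rewrite (proj2 (Nat.eqb_eq n T) HT) in *.
    pose proof (fsum_nonneg M _ Hnn) as Hx; cbv beta in Hx.
    (* A finished run would give a crossing at some [m <= n]: at [n] this contradicts [Hnc], before
       [n] it contradicts [Hs2]. *)
    assert (Hu : undone (run (nth j cb nil) y) = 1).
    { unfold undone; destruct (done (run (nth j cb nil) y)) eqn:Hd; [exfalso|reflexivity].
      destruct (done_stops j y k Hj ltac:(lia) Hd) as [m [Hm Hc]].
      destruct (Nat.eq_dec m n) as [E|E].
      - rewrite firstn_all2 in Hc by lia; congruence.
      - specialize (Hs2 m ltac:(lia)); unfold stop_rule in Hs2.
        rewrite firstn_map, Hc, !orb_true_r in Hs2; discriminate. }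
    rewrite Hu; pose proof (ind_le1 (true && negb (Nat.eqb 0 j))); lra.
Qed.

Lemma prob_event_two p n E :
  prob_event L 2 (fun u => if Nat.eqb u 0 then p else 1 - p) M (W true) (W false) enc_rule n E
  = p * fsum M (fun j => / INR M * path (nth j cb nil) n
        (fun y => if E 0%nat j (map fst y) (map snd y) then 1 else 0))
  + (1 - p) * fsum M (fun j => / INR M * path (nth j cb nil) n
        (fun y => if E 1%nat j (map fst y) (map snd y) then 1 else 0)).
Proof.
  unfold prob_event; simpl fsum at 1; rewrite Rplus_0_l.
  f_equal; f_equal; apply fsum_ext; intros j _; apply Rmult_eq_compat_l.
  - now apply (seqsum_chprob_path (nth j cb nil) enc_rule 0 j n
      (fun y1 y2 => if E 0%nat j y1 y2 then 1 else 0)).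
  - now apply (seqsum_chprob_path (nth j cb nil) enc_rule 1 j n
      (fun y1 y2 => if E 1%nat j y1 y2 then 1 else 0)).
Qed.

Lemma fsum_cut n m g : (forall i, (i < m)%nat -> 0 <= g i) ->
  fsum n (fun i => if Nat.ltb i m then g i else 0) <= fsum m g.
Proof.
  intros H; rewrite <- (fsum_ext m (fun i => if Nat.ltb i m then g i else 0)).
  2:{ intros i Hi; now rewrite (proj2 (Nat.ltb_lt i m) Hi). }
  destruct (Nat.le_gt_cases n m) as [Hn|Hn].
  - apply fsum_mono_nonneg; [assumption|]; intros i Hi; destruct (Nat.ltb_spec i m); auto; lra.
  - apply Req_le, fsum_truncate; [lia|]; intros i Hi.
    destruct (Nat.ltb_spec i m); [lia|reflexivity].
Qed.

Lemma path_nonneg a n F : (forall y, path_supp n y -> 0 <= F y) -> 0 <= path a n F.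
Proof. apply (exp_ge_const _ _ (path_expectation a n)). Qed.

Lemma total_time_le p H : 0 <= p <= 1 -> (1 <= M)%nat ->
  fsum H (fun n => prob_event L 2 (fun u => if Nat.eqb u 0 then p else 1 - p) M
    (W true) (W false) enc_rule n
    (fun u j y1 y2 => negb (stopped_by (stop_rule true) u y1 n &&
                            stopped_by (stop_rule false) u y2 n)))
  <= (1 - p) * (/ INR M * fsum M (fun j => mean_time (nth j cb nil))).
Proof.
  intros Hp HM1; assert (HMpos : 0 < / INR M) by (apply Rinv_0_lt_compat, lt_0_INR; lia).
  apply Rle_trans with (fsum H (fun n => (1 - p) * (/ INR M * fsum M (fun j =>
    if Nat.ltb n T then path (nth j cb nil) n (fun y => undone (run (nth j cb nil) y)) else 0)))).
  - apply fsum_le; intros n _; rewrite prob_event_two.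
    (* The branch [u = 0] has stopped by time 0 and adds no delay. *)
    rewrite (fsum_zero M (fun j => / INR M * path (nth j cb nil) n _)).
    + rewrite Rmult_0_r, Rplus_0_l; apply Rmult_le_compat_l; [lra|].
      rewrite <- fsum_scal; apply fsum_le; intros j Hj; apply Rmult_le_compat_l; [lra|].
      destruct (Nat.ltb n T) eqn:HT.
      * apply (exp_mono _ _ (path_expectation _ n)); intros y [Hy _].
        pose proof (time_event_le j y n Hj Hy) as Hx; now rewrite HT in Hx.
      * apply (exp_le_const _ _ (path_expectation _ n)); intros y [Hy _].
        pose proof (time_event_le j y n Hj Hy) as Hx; now rewrite HT in Hx.
    + intros j _; rewrite (exp_ext _ _ (path_expectation _ n) _ (fun _ => 0)).
      { rewrite (exp_const _ _ (path_expectation _ n)); ring. }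
      intros y _; rewrite !(stopped_by_intro _ _ _ n 0) by (reflexivity || lia); reflexivity.
  - rewrite !fsum_scal; apply Rmult_le_compat_l; [lra|]; apply Rmult_le_compat_l; [lra|].
    rewrite fsum_swap; apply fsum_le; intros j Hj; apply fsum_cut.
    intros i _; apply path_nonneg; intros; apply undone_nonneg.
Qed.

Lemma total_error_le k p H : 0 <= p <= 1 -> (1 <= M)%nat ->
  fsum H (fun n => prob_event L 2 (fun u => if Nat.eqb u 0 then p else 1 - p) M
    (W true) (W false) enc_rule n
    (fun u j y1 y2 => stops_at (stop_rule k) u (if k then y1 else y2) n &&
       negb (Nat.eqb (dec_rule k u (if k then y1 else y2)) j)))
  <= p + / INR M * fsum M (fun j => late (nth j cb nil) +
       fsum M (fun i => if Nat.eqb i j then 0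
                        else confusion k (nth j cb nil) (nth i cb nil))).
Proof.
  intros Hp HM1; assert (HMpos : 0 < / INR M) by (apply Rinv_0_lt_compat, lt_0_INR; lia).
  set (g := fun n j y => fsum M (fun i => if Nat.eqb i j then 0
                        else pseudo_score k (nth i cb nil) (map (proj k) y))
       + (if Nat.eqb n T then undone (run (nth j cb nil) y) else 0)).
  assert (Hg : forall n j, (n <= T)%nat -> (j < M)%nat -> 0 <= path (nth j cb nil) n (g n j)).
  { intros n j Hn Hj; apply path_nonneg; intros y [Hy Hy'].
    apply Rplus_le_le_0_compat; [|destruct (Nat.eqb n T); [apply undone_nonneg|lra]].
    apply fsum_nonneg; intros i Hi; destruct (Nat.eqb i j); [lra|].
    destruct (word_spec i Hi); apply pseudo_score_nonneg; auto.
    - rewrite length_map; lia.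
    - apply Forall_map; apply Hy'. }
  apply Rle_trans with (fsum H (fun n => p * (if Nat.ltb n 1 then 1 else 0) +
    (1 - p) * (/ INR M * fsum M (fun j =>
    if Nat.ltb n (S T) then path (nth j cb nil) n (g n j) else 0)))).
  - apply fsum_le; intros n _; rewrite prob_event_two; apply Rplus_le_compat.
    + apply Rmult_le_compat_l; [lra|].
      (* With [u = 0] stopping happens only at [n = 0], so this branch errs with total weight at
         most [p], whatever is decoded. *)
      apply Rle_trans with (fsum M (fun _ => / INR M * (if Nat.ltb n 1 then 1 else 0))).
      * apply fsum_le; intros j Hj; apply Rmult_le_compat_l; [lra|].
        apply (exp_le_const _ _ (path_expectation _ n)); intros y [Hy _].
        destruct (Nat.ltb_spec n 1); [apply ind_le1|].
        replace (stops_at _ _ _ _) with false; [simpl; lra|symmetry].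
        apply not_true_iff_false; intros Hs; apply stops_at_inv in Hs.
        -- now specialize (proj2 Hs 0%nat ltac:(lia)).
        -- destruct k; now rewrite length_map.
      * rewrite fsum_const, <- Rmult_assoc, Rinv_r, Rmult_1_l; [lra|].
        apply not_0_INR; lia.
    + apply Rmult_le_compat_l; [lra|].
      rewrite <- fsum_scal; apply fsum_le; intros j Hj; apply Rmult_le_compat_l; [lra|].
      assert (He : forall y, path_supp n y ->
        (if stops_at (stop_rule k) 1 (if k then map fst y else map snd y) n &&
         negb (Nat.eqb (dec_rule k 1 (if k then map fst y else map snd y)) j) then 1 else 0)
        <= if Nat.ltb n (S T) then g n j y else 0).
      { intros y Hy; pose proof (error_event_le k j y n Hj Hy) as Hx.
        destruct k; exact Hx. }
      destruct (Nat.ltb n (S T)).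
      * now apply (exp_mono _ _ (path_expectation _ n)).
      * now apply (exp_le_const _ _ (path_expectation _ n)).
  - rewrite fsum_add; apply Rplus_le_compat.
    + rewrite fsum_scal.
      pose proof (fsum_cut H 1 (fun _ => 1) ltac:(intros; lra)) as Hx; simpl fsum at 2 in Hx.
      cbv beta in Hx; nra.
    + rewrite !fsum_scal.
      apply Rle_trans with (1 * (/ INR M * fsum H (fun n => fsum M (fun j =>
        if Nat.ltb n (S T) then path (nth j cb nil) n (g n j) else 0)))).
      { apply Rmult_le_compat_r; [|lra]; apply Rmult_le_pos; [lra|].
        apply fsum_nonneg; intros n _; apply fsum_nonneg; intros j Hj.
        destruct (Nat.ltb_spec n (S T)); [apply Hg; auto; lia|lra]. }
      rewrite Rmult_1_l; apply Rmult_le_compat_l; [lra|].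
      rewrite fsum_swap; apply fsum_le; intros j Hj.
      eapply Rle_trans; [apply fsum_cut; intros i Hi; apply Hg; auto; lia|].
      unfold g.
      rewrite (fsum_ext (S T) _ (fun n => fsum M (fun i => if Nat.eqb i j then 0 else
          path (nth j cb nil) n (fun y => pseudo_score k (nth i cb nil) (map (proj k) y)))
        + (if Nat.eqb n T then late (nth j cb nil) else 0))).
      * rewrite fsum_add, Rplus_comm; apply Rplus_le_compat.
        -- simpl; rewrite Nat.eqb_refl, fsum_zero; [lra|].
           intros i Hi; destruct (Nat.eqb_spec i T); [lia|reflexivity].
        -- rewrite fsum_swap; apply fsum_le; intros i _.
           destruct (Nat.eqb i j); [rewrite fsum_zero; auto; lra|apply Rle_refl].
      * intros n _; rewrite (exp_add _ _ (path_expectation _ n)); f_equal.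
        -- rewrite (exp_fsum _ _ (path_expectation _ n)); apply fsum_ext; intros i _.
           destruct (Nat.eqb i j); [apply (exp_const _ _ (path_expectation _ n))|reflexivity].
        -- destruct (Nat.eqb_spec n T) as [->|]; [reflexivity|].
           apply (exp_const _ _ (path_expectation _ n)).
Qed.

End Code.

(** * Existence of a code by averaging over codebooks *)

Lemma exp_lsum {A C} (supp : A -> Prop) E (HE : expectation supp E) (l : list C) f :
  E (fun a => lsum l (f a)) = lsum l (fun s => E (fun a => f a s)).
Proof.
  induction l as [|s l IH]; simpl; [apply (exp_const _ _ HE)|].
  now rewrite (exp_add _ _ HE), IH.
Qed.

(** The outputs of the sent word are held fixed while the independent competitor is averaged. The
    factors count the [T + 1] times and the switching patterns. *)
Lemma confusion_expectation_le k T a :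
  iid letter T (confusion T k a) <= INR (S T) * (2 ^ nblocks T * exp (- gam)).
Proof.
  pose proof (iid_expectation _ _ letter_expectation T) as HT.
  unfold confusion; rewrite (exp_fsum _ _ HT), <- fsum_const.
  apply fsum_le; intros n Hn.
  rewrite <- (exp_comm _ _ HT _ _ (exp_linear _ _ (path_expectation a n))
    (fun a' y => pseudo_score T k a' (map (proj k) y))).
  apply (exp_le_const _ _ (path_expectation a n)); intros y [Hy Hy'].
  unfold pseudo_score.
  rewrite (exp_lsum _ _ HT (bitlists (nblocks T))
    (fun a' s => exp (- gam) * score k s a' (map (proj k) y))), <- bitlists_length.
  apply lsum_le_const; intros s; rewrite (exp_scal _ _ HT).
  rewrite <- (Rmult_1_r (exp (- gam))) at 2.
  apply Rmult_le_compat_l; [apply Rlt_le, exp_pos|].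
  apply score_expectation_le1; [rewrite length_map; lia|].
  apply Forall_map; apply Hy'.
Qed.

(* [A] trades the error probabilities against the expected decoding time when one
   codebook has to be good for both. *)
Lemma vlf_code_of_chain T M p A tau0 l0 nbar eps :
  (1 <= M)%nat -> 0 <= p <= 1 -> 0 < A ->
  fsum T (fun n => chain n undone) <= tau0 -> chain T undone <= l0 ->
  let D := tau0 + 2 * A * l0 +
    INR M * (A * (2 * (INR (S T) * (2 ^ nblocks T * exp (- gam))))) in
  (1 - p) * D <= nbar -> p + D / A <= eps ->
  vlf_code_exists N L (W true) (W false) nbar M eps.
Proof.
  intros HM Hp HA Htau Hl0 D HD1 HD2.
  pose proof (iid_expectation _ _ letter_expectation T) as HT.
  assert (Hlate : forall a, 0 <= late T a).
  { intros a; apply path_nonneg; intros; apply undone_nonneg. }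
  assert (Htime : forall a, 0 <= mean_time T a).
  { intros a; apply fsum_nonneg; intros n _; apply path_nonneg; intros; apply undone_nonneg. }
  assert (HMpos : 0 < / INR M) by (apply Rinv_0_lt_compat, lt_0_INR; lia).
  (* Time has weight 1 and each receiver's error weight [A]: the single bound [D] gives mean time at
     most [D] and errors at most [D / A] in the branch [u = 1]. *)
  destruct (random_coding _ _ nil M (fun a => mean_time T a + 2 * A * late T a)
    (fun a a' => A * (confusion T true a a' + confusion T false a a'))
    (tau0 + 2 * A * l0) (A * (2 * (INR (S T) * (2 ^ nblocks T * exp (- gam))))) HT)
    as (cb & Hlen & Hcb & Hsum).
  - rewrite (exp_add _ _ HT), (exp_scal _ _ HT); apply Rplus_le_compat.
    + unfold mean_time; rewrite (exp_fsum _ _ HT).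
      eapply Rle_trans; [apply Req_le, fsum_ext|exact Htau].
      intros n Hn; apply chain_of_long_path; lia.
    + apply Rmult_le_compat_l; [lra|]; unfold late.
      now rewrite chain_of_long_path.
  - intros a _; rewrite (exp_scal _ _ HT), (exp_add _ _ HT); apply Rmult_le_compat_l; [lra|].
    pose proof (confusion_expectation_le true T a); pose proof (confusion_expectation_le false T a).
    lra.
  - pose proof (pos_INR (S T)); pose proof (pow_le 2 (nblocks T) ltac:(lra)).
    pose proof (exp_pos (- gam)); repeat apply Rmult_le_pos; lra.
  - assert (Hconf : forall k j i, (j < M)%nat -> (i < M)%nat ->
      0 <= confusion T k (nth j cb nil) (nth i cb nil)).
    { intros k j i Hj Hi; apply fsum_nonneg; intros n Hn; apply path_nonneg; intros y [Hy Hy'].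
      rewrite Forall_forall in Hcb; destruct (Hcb (nth i cb nil)); [apply nth_In; lia|].
      apply pseudo_score_nonneg; auto; [rewrite length_map; lia|apply Forall_map; apply Hy']. }
    assert (Hsum' : / INR M * fsum M (fun j =>
        mean_time T (nth j cb nil) + 2 * A * late T (nth j cb nil) +
        fsum M (fun i => if Nat.eqb i j then 0 else
          A * (confusion T true (nth j cb nil) (nth i cb nil)
             + confusion T false (nth j cb nil) (nth i cb nil)))) <= D).
    { apply Rmult_le_reg_l with (INR M); [apply lt_0_INR; lia|].
      rewrite <- Rmult_assoc, Rinv_r, Rmult_1_l by (apply not_0_INR; lia).
      eapply Rle_trans; [exact Hsum|apply Req_le; unfold D; ring]. }
    assert (Hterm : forall j, (j < M)%nat -> 0 <= fsum M (fun i => if Nat.eqb i j then 0 else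
          A * (confusion T true (nth j cb nil) (nth i cb nil)
             + confusion T false (nth j cb nil) (nth i cb nil)))).
    { intros j Hj; apply fsum_nonneg; intros i Hi; destruct (Nat.eqb i j); [lra|].
      apply Rmult_le_pos; [lra|].
      pose proof (Hconf true j i Hj Hi); pose proof (Hconf false j i Hj Hi); lra. }
    assert (Herr : forall k H, fsum H (fun n =>
        prob_event L 2 (fun u => if Nat.eqb u 0 then p else 1 - p) M
        (W true) (W false) (enc_rule cb) n
        (fun u j y1 y2 => stops_at (stop_rule T M cb k) u (if k then y1 else y2) n &&
           negb (Nat.eqb (dec_rule T M cb k u (if k then y1 else y2)) j))) <= eps).
    { intros k H; eapply Rle_trans; [now apply total_error_le|].
      eapply Rle_trans; [|exact HD2]; apply Rplus_le_compat_l.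
      apply Rmult_le_reg_l with A; [assumption|].
      replace (A * (D / A)) with D by (field; lra).
      eapply Rle_trans; [|exact Hsum'].
      rewrite <- !fsum_scal; apply fsum_le; intros j Hj.
      rewrite <- Rmult_assoc, (Rmult_comm A), Rmult_assoc.
      apply Rmult_le_compat_l; [lra|].
      rewrite Rmult_plus_distr_l, <- fsum_scal; apply Rplus_le_compat.
      - pose proof (Htime (nth j cb nil)); pose proof (Hlate (nth j cb nil)); nra.
      - apply fsum_le; intros i Hi; destruct (Nat.eqb i j); [lra|].
        apply Rmult_le_compat_l; [lra|].
        pose proof (Hconf true j i Hj Hi); pose proof (Hconf false j i Hj Hi).
        destruct k; lra. }
    exists 2%nat, (fun u => if Nat.eqb u 0 then p else 1 - p), (enc_rule cb),
      (stop_rule T M cb true), (stop_rule T M cb false),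
      (dec_rule T M cb true), (dec_rule T M cb false).
    assert (Hdec : forall k u y, (dec_rule T M cb k u y < M)%nat).
    { intros k u y; unfold dec_rule; destruct (find _ _) as [j|] eqn:Hf; [|lia].
      apply find_some in Hf; destruct Hf as [Hf _]; apply in_seq in Hf; lia. }
    repeat split; try lia; try apply Hdec; try exact (Herr true); try exact (Herr false).
    + intros x _; destruct (Nat.eqb x 0); lra.
    + simpl; lra.
    + intros; apply encoder_lt.
    + intros H; eapply Rle_trans; [now apply total_time_le|].
      eapply Rle_trans; [|exact HD1]; apply Rmult_le_compat_l; [lra|].
      eapply Rle_trans; [|exact Hsum']; apply Rmult_le_compat_l; [lra|].
      apply fsum_le; intros j Hj; pose proof (Hterm j Hj).
      pose proof (Hlate (nth j cb nil)); nra.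
Qed.

(** * Information densities along the transmission *)

Hypothesis Hgam : 0 <= gam.
Hypothesis Ppos : forall s x, (x < N)%nat -> 0 < P s x.
Variable c : R.
Hypothesis Hc : 0 <= c.
Hypothesis Hratio : forall k s x y, (x < N)%nat -> (y < L)%nat -> 0 < W k x y ->
  Rabs (ln (ratio k s x y)) <= c.

Definition dens (q : state) (k : bool) : R := ln (lr q k).

Definition incr (k s : bool) (w : (nat * nat) * (nat * nat)) : R :=
  ln (ratio k s (sel s (fst w)) (proj k (snd w))).

Definition drift (k s : bool) : R := info N L (P s) (W k).

Lemma stepE_incr k s : stepE s (incr k s) = drift k s.
Proof.
  unfold stepE, incr, drift, info; simpl fst; simpl snd.
  rewrite (exp_ext _ _ (letter_expectation) _ (fun p =>
    (fun x => wsum L (W k x) (fun y => ln (ratio k s x y))) (sel s p))).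
  - apply (letter_sel s (fun x => wsum L (W k x) (fun y => ln (ratio k s x y)))).
  - intros p Hp; cbv beta; set (x := sel s p).
    assert (Hx : (x < N)%nat) by now apply sel_lt.
    unfold chan; destruct k; simpl.
    + f_equal; apply functional_extensionality; intros y.
      apply (exp_const _ _ (wsum_expectation L _ (HW false x Hx))).
    + apply (exp_const _ _ (wsum_expectation L _ (HW true x Hx))).
Qed.

(** The last clause bounds the overshoot: before the final step some receiver is still below [gam],
    and one step adds at most [c]. *)
Definition inv (q : state) : Prop :=
  state_wf q /\ (forall k, 0 < lr q k) /\ exists k, dens q k <= gam + c.

Lemma not_done q : (forall k, 0 < lr q k) -> done q = false -> exists k, dens q k < gam.
Proof.
  intros Hpos Hd; unfold done in Hd; apply andb_false_iff in Hd.
  destruct Hd as [Hd|Hd]; apply Rleb_false in Hd; [exists true|exists false]; unfold dens;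
    rewrite <- (ln_exp gam); apply ln_increasing; auto.
Qed.

Lemma ratio_pos s w k : step_supp s w -> 0 < ratio k s (sel s (fst w)) (proj k (snd w)).
Proof.
  intros [Hl Hch]; destruct (Hch k) as [Hy Hw].
  pose proof (sel_lt s _ Hl) as Hx.
  unfold ratio; apply Rmult_lt_0_compat; [assumption|]; apply Rinv_0_lt_compat.
  apply (outd_pos s k (sel s (fst w))); auto.
Qed.

Lemma incr_bound s w k : step_supp s w -> Rabs (incr k s w) <= c.
Proof.
  intros [Hl Hch]; destruct (Hch k) as [Hy Hw]; apply Hratio; auto; now apply sel_lt.
Qed.

Lemma dens_step q w k : (forall k, 0 < lr q k) -> done q = false -> step_supp (cur q) w ->
  dens (step q w) k = dens q k + incr k (cur q) w.
Proof.
  intros Hpos Hd Hw; unfold dens, step; rewrite Hd; simpl.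
  apply ln_mult; [auto|now apply ratio_pos].
Qed.

Lemma inv_init : inv init.
Proof.
  split; [now apply init_wf|]; split; [simpl; intros; lra|].
  exists true; unfold dens; simpl; rewrite ln_1; lra.
Qed.

Lemma inv_step q w : inv q -> step_supp (cur q) w -> inv (step q w).
Proof.
  intros (Hwf & Hpos & Hk) Hw; split; [now apply step_wf|].
  destruct (done q) eqn:Hd.
  - unfold step; rewrite Hd; auto.
  - split.
    + intros k; unfold step; rewrite Hd; simpl.
      apply Rmult_lt_0_compat; [auto|now apply ratio_pos].
    + destruct (not_done q Hpos Hd) as [k Hlt]; exists k; rewrite dens_step by assumption.
      pose proof (incr_bound (cur q) w k Hw) as Hb; pose proof (Rle_abs (incr k (cur q) w)); lra.
Qed.

Lemma chain_inv n : expectation inv (chain n).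
Proof. apply chain_expectation; auto using inv_init, inv_step. Qed.

Lemma step_done q w : done q = true -> step q w = q.
Proof. intros Hd; unfold step; now rewrite Hd. Qed.

Lemma stepE_done q (F : state -> R) : done q = true -> stepE (cur q) (fun w => F (step q w)) = F q.
Proof.
  intros Hd; pose proof (stepE_expectation (cur q)) as HE.
  rewrite (exp_ext _ _ HE _ (fun _ => F q)); [apply (exp_const _ _ HE)|].
  intros w _; now rewrite step_done.
Qed.

Lemma chain_step_le (F G : state -> R) n :
  (forall q, inv q -> stepE (cur q) (fun w => F (step q w)) <= G q) ->
  chain (S n) F <= chain n G.
Proof. intros H; apply (exp_mono _ _ (chain_inv n)); exact H. Qed.

(** Chernoff bound. [F k], set to 0 on frozen states, shrinks on average by the factor [exp kap] per
    step, and in an unfinished state the receiver below [gam] has [F k >= 1]. *)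
Lemma chain_undone_le nu th T :
  0 < th -> th * c <= 1 / 2 -> (forall k s, nu <= drift k s) ->
  chain T undone <= 2 * exp (th * gam + INR T * (2 * th ^ 2 * c ^ 2 - th * nu)).
Proof.
  intros Hth Hthc Hnu.
  set (kap := 2 * th ^ 2 * c ^ 2 - th * nu).
  set (F := fun k q => if done q then 0 else exp (- th * (dens q k - gam))).
  assert (HF : forall k n, chain n (F k) <= exp (th * gam + INR n * kap)).
  { intros k; induction n as [|n IH].
    - simpl; unfold F; destruct (done init).
      + apply Rlt_le, exp_pos.
      + apply exp_le_compat; unfold dens; simpl; rewrite ln_1; lra.
    - apply Rle_trans with (chain n (fun q => exp kap * F k q)).
      + apply chain_step_le; intros q (Hwf & Hpos & _).
        pose proof (stepE_expectation (cur q)) as HE.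
        destruct (done q) eqn:Hd.
        * rewrite stepE_done by assumption; unfold F; rewrite Hd; lra.
        * apply Rle_trans with (stepE (cur q)
            (fun w => exp (- th * (dens q k - gam)) * exp (- th * incr k (cur q) w))).
          -- apply (exp_mono _ _ HE); intros w Hw; unfold F.
             destruct (done (step q w)).
             ++ apply Rlt_le, Rmult_lt_0_compat; apply exp_pos.
             ++ rewrite <- exp_plus, dens_step by assumption; apply Req_le; f_equal; ring.
          -- rewrite (exp_scal _ _ HE); unfold F; rewrite Hd, Rmult_comm.
             apply Rmult_le_compat_r; [apply Rlt_le, exp_pos|].
             eapply Rle_trans.
             ++ apply (exp_moment _ _ HE (incr k (cur q)) c).
                ** intros w Hw; now apply incr_bound.
                ** rewrite Rabs_Ropp, Rabs_pos_eq; lra.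
             ++ apply exp_le_compat; rewrite stepE_incr; unfold kap.
                pose proof (Hnu k (cur q)); nra.
      + rewrite (exp_scal _ _ (chain_inv n)), S_INR.
        replace (th * gam + (INR n + 1) * kap) with (kap + (th * gam + INR n * kap)) by ring.
        rewrite exp_plus; apply Rmult_le_compat_l; [apply Rlt_le, exp_pos|exact IH]. }
  apply Rle_trans with (chain T (fun q => F true q + F false q)).
  - apply (exp_mono _ _ (chain_inv T)); intros q (_ & Hpos & _); unfold F, undone.
    destruct (done q) eqn:Hd; [lra|].
    destruct (not_done q Hpos Hd) as [k Hk].
    assert (1 <= exp (- th * (dens q k - gam))) by (rewrite <- exp_0; apply exp_le_compat; nra).
    pose proof (exp_pos (- th * (dens q true - gam))).
    pose proof (exp_pos (- th * (dens q false - gam))).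
    destruct k; lra.
  - rewrite (exp_add _ _ (chain_inv T)).
    pose proof (HF true T); pose proof (HF false T); lra.
Qed.

Definition gap (q : state) : R := dens q true - dens q false.

(** The convex combination [Z] of the densities gains at least [C] on average in every unfinished
    step, so its final mean bounds the expected time. *)
Lemma optional_stopping lam C T :
  0 <= lam <= 1 -> (forall s, C <= lam * drift true s + (1 - lam) * drift false s) ->
  C * fsum T (fun n => chain n undone) <= gam + c + chain T (fun q => Rabs (gap q)).
Proof.
  intros Hlam HC.
  set (Z := fun q => lam * dens q true + (1 - lam) * dens q false).
  assert (HZ : C * fsum T (fun n => chain n undone) <= chain T Z).
  { induction T as [|T IH].
    - simpl; unfold Z, dens; simpl; rewrite ln_1; lra.
    - simpl fsum; apply Rle_trans with (chain T (fun q => Z q + C * undone q)).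
      + rewrite (exp_add _ _ (chain_inv T)), (exp_scal _ _ (chain_inv T)); lra.
      + simpl; apply (exp_mono _ _ (chain_inv T)); intros q (_ & Hpos & _).
        pose proof (stepE_expectation (cur q)) as HE.
        unfold undone; destruct (done q) eqn:Hd.
        * rewrite stepE_done by assumption; lra.
        * rewrite (exp_ext _ _ HE _ (fun w => Z q +
            (lam * incr true (cur q) w + (1 - lam) * incr false (cur q) w))).
          -- rewrite !(exp_add _ _ HE), (exp_const _ _ HE), !(exp_scal _ _ HE), !stepE_incr.
             pose proof (HC (cur q)); lra.
          -- intros w Hw; unfold Z; rewrite !dens_step by assumption; ring. }
  eapply Rle_trans; [exact HZ|].
  rewrite <- (exp_const _ _ (chain_inv T) (gam + c)) at 1.
  rewrite <- (exp_add _ _ (chain_inv T)).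
  (* One density is at most [gam + c] and the other exceeds it by at most the gap; [Z] lies between
     the two. *)
  apply (exp_mono _ _ (chain_inv T)); intros q (_ & _ & [k Hk]); unfold Z, gap.
  pose proof (Rle_abs (dens q true - dens q false)).
  pose proof (Rle_abs (- (dens q true - dens q false))) as Hn; rewrite Rabs_Ropp in Hn.
  destruct k; nra.
Qed.

Definition sgn (d : bool) : R := if d then 1 else -1.

(* The mode [cur q = d] pushes [sgn d * gap] down. In the other mode it may grow, but
   by a factor of at most [exp kap] per step until the end of the block, and such a
   block starts with [sgn d * gap <= 0]. *)
Definition potential (th kap : R) (d : bool) (q : state) : R :=
  exp (th * (sgn d * gap q) +
       if Bool.eqb (cur q) d then 0 else kap * INR (B - tm q mod B)).

(** * Drift analysis of the gap between the two densities *)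

Section Gap.

Variables (th kap : R).
Hypothesis Hth : 0 < th.
Hypothesis Hthc : th * (2 * c) <= 1 / 2.
Hypothesis Hkap : 0 <= kap.
(** The negative drift must absorb the second-order term of [exp_moment], with range [2 * c] for a
    difference of two increments. *)
Hypothesis Hgood : forall d,
  th * (sgn d * (drift true d - drift false d)) + 2 * th ^ 2 * (2 * c) ^ 2 <= 0.
Hypothesis Hbad : forall d,
  th * (sgn d * (drift true (negb d) - drift false (negb d))) + 2 * th ^ 2 * (2 * c) ^ 2 <= kap.

Lemma cur_step q w : state_wf q -> done q = false -> step_supp (cur q) w ->
  (forall k, 0 < lr q k) ->
  ((S (tm q) mod B <> 0)%nat /\ cur (step q w) = cur q /\
    tm (step q w) mod B = S (tm q mod B))%nat \/
  (tm (step q w) mod B = 0)%nat /\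
    (cur (step q w) = true /\ 0 <= gap (step q w) \/
     cur (step q w) = false /\ gap (step q w) <= 0).
Proof.
  intros Hwf Hd Hw Hpos.
  assert (Hlr : forall k, 0 < lr (step q w) k).
  { intros k; unfold step; rewrite Hd; simpl.
    apply Rmult_lt_0_compat; [auto|now apply ratio_pos]. }
  destruct (Nat.eq_dec (S (tm q) mod B) 0) as [E|E]; [right|left].
  - destruct (next_boundary _ E) as [E1 E2].
    assert (Htm : tm (step q w) = S (tm q)) by (unfold step; now rewrite Hd).
    rewrite Htm; split; [assumption|].
    assert (Hcur : cur (step q w) = Rleb (lr (step q w) false) (lr (step q w) true)).
    { unfold cur; rewrite Htm, E1; unfold step; rewrite Hd; cbn [sg lr].
      rewrite (proj2 (Nat.eqb_eq _ _) E), app_nth2 by (rewrite Hwf; lia).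
      rewrite Hwf, Nat.sub_diag; reflexivity. }
    rewrite Hcur; unfold gap, dens.
    destruct (Rleb (lr (step q w) false) (lr (step q w) true)) eqn:Hb; [left|right];
      (split; [reflexivity|]).
    + apply Rleb_true in Hb; pose proof (ln_le_compat _ _ (Hlr false) Hb); lra.
    + apply Rleb_false in Hb; pose proof (ln_increasing _ _ (Hlr true) Hb); lra.
  - destruct (next_not_boundary _ E) as [E1 E2].
    split; [assumption|]; unfold cur, step; rewrite Hd; cbn [sg tm].
    rewrite (proj2 (Nat.eqb_neq _ _) E), E1; auto.
Qed.

(** Inside a block, negative drift or one unit [kap] of the remaining allowance offsets the
    exponential moment. The additive term pays for a new block in the mode opposite to [d]. *)
Lemma potential_step d q : inv q ->
  stepE (cur q) (fun w => potential th kap d (step q w))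
  <= potential th kap d q + exp (kap * INR B).
Proof.
  intros (Hwf & Hpos & _).
  pose proof (stepE_expectation (cur q)) as HE.
  pose proof (exp_pos (kap * INR B)) as HK.
  destruct (done q) eqn:Hd; [rewrite stepE_done by assumption; lra|].
  pose proof (Nat.mod_upper_bound (tm q) B ltac:(lia)) as Hr.
  set (rest := if Bool.eqb (cur q) d then 0 else kap * INR (B - S (tm q mod B))).
  assert (Hrest : 0 <= rest).
  { unfold rest; destruct (Bool.eqb (cur q) d); [lra|].
    apply Rmult_le_pos; [assumption|apply pos_INR]. }
  set (X := fun w => sgn d * (incr true (cur q) w - incr false (cur q) w)).
  assert (Hgap : forall w, step_supp (cur q) w -> sgn d * gap (step q w) = sgn d * gap q + X w).
  { intros w Hw; unfold gap, X; rewrite !dens_step by assumption; ring. }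
  apply Rle_trans with (stepE (cur q) (fun w =>
    exp (th * (sgn d * gap q) + rest) * exp (th * X w) + exp (kap * INR B))).
  - apply (exp_mono _ _ HE); intros w Hw.
    rewrite <- exp_plus.
    pose proof (exp_pos (th * (sgn d * gap q) + rest + th * X w)) as HX.
    unfold potential at 1; rewrite Hgap by assumption.
    destruct (cur_step q w Hwf Hd Hw Hpos) as [(E & Hc1 & Hc2)|(Hm & Hcase)].
    + rewrite Hc1, Hc2; fold rest.
      replace (th * (sgn d * gap q + X w) + rest) with (th * (sgn d * gap q) + rest + th * X w)
        by ring; lra.
    + rewrite Hm, Nat.sub_0_r.
      destruct (Bool.eqb (cur (step q w)) d) eqn:Ed.
      * apply Rle_trans with (exp (th * (sgn d * gap q) + rest + th * X w)); [|lra].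
        apply exp_le_compat; lra.
      * apply Rle_trans with (exp (kap * INR B)); [|lra].
        apply exp_le_compat; rewrite <- Hgap by assumption.
        (* The block received the mode opposite to [d] exactly because the gap has this sign. *)
        assert (sgn d * gap (step q w) <= 0).
        { destruct Hcase as [[Hq Hg]|[Hq Hg]]; rewrite Hq in Ed; destruct d; simpl in *;
            try discriminate; lra. }
        nra.
  - rewrite (exp_add _ _ HE), (exp_scal _ _ HE), (exp_const _ _ HE); apply Rplus_le_compat_r.
    eapply Rle_trans.
    + apply Rmult_le_compat_l; [apply Rlt_le, exp_pos|].
      apply (exp_moment _ _ HE X (2 * c)).
      * intros w Hw; unfold X; rewrite Rabs_mult.
        replace (Rabs (sgn d)) with 1
          by (destruct d; simpl; [rewrite Rabs_R1|rewrite Rabs_left by lra]; lra).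
        pose proof (incr_bound _ w true Hw); pose proof (incr_bound _ w false Hw).
        unfold Rminus; eapply Rle_trans; [apply Req_le, Rmult_1_l|].
        eapply Rle_trans; [apply Rabs_triang|]; rewrite Rabs_Ropp; lra.
      * rewrite Rabs_pos_eq; lra.
    + rewrite <- exp_plus; unfold potential; apply exp_le_compat.
      assert (HEX : stepE (cur q) X = sgn d * (drift true (cur q) - drift false (cur q))).
      { unfold X; rewrite (exp_scal _ _ HE).
        rewrite (exp_ext _ _ HE _ (fun w => incr true (cur q) w + (-1) * incr false (cur q) w))
          by (intros; ring).
        rewrite (exp_add _ _ HE), (exp_scal _ _ HE), !stepE_incr; ring. }
      rewrite HEX; unfold rest; destruct (Bool.eqb (cur q) d) eqn:Ed.
      * apply Bool.eqb_prop in Ed; rewrite Ed; pose proof (Hgood d); lra.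
      * assert (cur q = negb d) as -> by (destruct (cur q), d; simpl in *; congruence).
        replace (B - tm q mod B)%nat with (S (B - S (tm q mod B))) by lia.
        rewrite S_INR; pose proof (Hbad d); lra.
Qed.

Lemma potential_chain d T : chain T (potential th kap d) <= (1 + INR T) * exp (kap * INR B).
Proof.
  induction T as [|T IH].
  - simpl; rewrite Rplus_0_r, Rmult_1_l; unfold potential; apply exp_le_compat.
    unfold gap, dens; simpl; rewrite ln_1, Nat.Div0.mod_0_l, Nat.sub_0_r.
    assert (0 <= kap * INR B) by (apply Rmult_le_pos; [assumption|apply pos_INR]).
    destruct (Bool.eqb _ d); lra.
  - apply Rle_trans with (chain T (fun q => potential th kap d q + exp (kap * INR B))).
    + apply chain_step_le; intros q Hq; now apply potential_step.
    + rewrite (exp_add _ _ (chain_inv T)), (exp_const _ _ (chain_inv T)), S_INR; lra.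
Qed.

(** Jensen's inequality in tangent form, [x <= h + exp (x - h)], with [exp h] the bound of
    [potential_chain]: the two signs then contribute at most 1 each. *)
Lemma gap_chain T :
  chain T (fun q => Rabs (gap q)) <= (kap * INR B + ln (1 + INR T) + 2) / th.
Proof.
  pose proof (pos_INR T) as HT.
  set (h := kap * INR B + ln (1 + INR T)).
  assert (Hh : exp (- h) * ((1 + INR T) * exp (kap * INR B)) = 1).
  { unfold h; rewrite exp_Ropp, exp_plus, exp_ln by lra.
    pose proof (exp_pos (kap * INR B)); field; lra. }
  apply Rle_trans with (chain T (fun q =>
    h / th + exp (- h) / th * (potential th kap true q + potential th kap false q))).
  - apply (exp_mono _ _ (chain_inv T)); intros q _.
    assert (Hp : forall d, exp (th * (sgn d * gap q)) <= potential th kap d q).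
    { intros d; unfold potential; apply exp_le_compat.
      assert (0 <= kap * INR (B - tm q mod B)) by (apply Rmult_le_pos; [assumption|apply pos_INR]).
      destruct (Bool.eqb (cur q) d); lra. }
    assert (Hx : forall d, sgn d * gap q <=
      h / th + exp (- h) / th * (potential th kap true q + potential th kap false q)).
    { intros d; apply Rmult_le_reg_l with th; [assumption|].
      replace (th * (h / th + exp (- h) / th *
          (potential th kap true q + potential th kap false q)))
        with (h + exp (- h) * (potential th kap true q + potential th kap false q))
        by (field; lra).
      pose proof (exp_ineq1_le (th * (sgn d * gap q) - h)) as He.
      unfold Rminus in He; rewrite exp_plus in He.
      pose proof (exp_pos (- h)).
      assert (exp (th * (sgn d * gap q)) <= potential th kap true q + potential th kap false q).
      { pose proof (Hp d).
        assert (0 < potential th kap true q) by apply exp_pos.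
        assert (0 < potential th kap false q) by apply exp_pos.
        destruct d; lra. }
      nra. }
    pose proof (Hx true) as H1; pose proof (Hx false) as H2; unfold sgn in H1, H2.
    apply Rabs_le; lra.
  - rewrite (exp_add _ _ (chain_inv T)), (exp_const _ _ (chain_inv T)),
      (exp_scal _ _ (chain_inv T)), (exp_add _ _ (chain_inv T)).
    pose proof (potential_chain true T) as H1; pose proof (potential_chain false T) as H2.
    pose proof (exp_pos (- h)) as He.
    apply Rmult_le_reg_l with th; [assumption|].
    match goal with |- th * (_ + _ * ?S) <= _ => set (s := S) in * end.
    replace (th * (h / th + exp (- h) / th * s)) with (h + exp (- h) * s) by (field; lra).
    replace (th * ((h + 2) / th)) with (h + 2) by (field; lra).
    assert (exp (- h) * s <= exp (- h) * (2 * ((1 + INR T) * exp (kap * INR B)))).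
    { apply Rmult_le_compat_l; unfold s; lra. }
    lra.
Qed.

End Gap.

End Scheme.

(** * Perturbing the optimal input distribution *)

Lemma ln_le_minus_one x : 0 < x -> ln x <= x - 1.
Proof.
  intros Hx; pose proof (exp_ineq1_le (ln x)) as H; rewrite exp_ln in H by assumption; lra.
Qed.

Lemma kl_lower n p q :
  (forall y, (y < n)%nat -> 0 <= p y /\ 0 <= q y /\ (0 < p y -> 0 < q y)) ->
  fsum n p - fsum n q <= fsum n (fun y => p y * ln (p y / q y)).
Proof.
  intros H; rewrite <- fsum_sub; apply fsum_le; intros y Hy.
  destruct (H y Hy) as ([Hp|Hp] & Hq & Hpq); [|rewrite <- Hp; lra].
  specialize (Hpq Hp).
  assert (Hqp : 0 < q y / p y) by (apply Rdiv_lt_0_compat; lra).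
  pose proof (ln_le_minus_one _ Hqp) as Hln.
  replace (p y / q y) with (/ (q y / p y)) by (field; lra).
  rewrite ln_Rinv by assumption.
  apply Rle_trans with (p y * (1 - q y / p y)); [apply Req_le; field; lra|].
  apply Rmult_le_compat_l; lra.
Qed.

(** Termwise [ln u <= u - 1] at [u = p / q], since [p (p / q - 1) = (p - q)^2 / q + (p - q)]:
    divergence is at most chi-square. *)
Lemma kl_upper n p q :
  (forall y, (y < n)%nat -> 0 <= p y /\ 0 <= q y /\ (0 < p y -> 0 < q y)) ->
  fsum n (fun y => p y * ln (p y / q y))
  <= fsum n (fun y => (p y - q y) ^ 2 / q y) + (fsum n p - fsum n q).
Proof.
  intros H; rewrite <- fsum_sub, <- fsum_add; apply fsum_le; intros y Hy.
  destruct (H y Hy) as ([Hp|Hp] & Hq & Hpq).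
  - specialize (Hpq Hp).
    assert (Hpq' : 0 < p y / q y) by (apply Rdiv_lt_0_compat; lra).
    pose proof (ln_le_minus_one _ Hpq') as Hln.
    apply Rle_trans with (p y * (p y / q y - 1)); [apply Rmult_le_compat_l; lra|].
    apply Req_le; field; lra.
  - rewrite <- Hp; destruct Hq as [Hq|Hq].
    + replace ((0 - q y) ^ 2 / q y) with (q y) by (field; lra); lra.
    + rewrite <- Hq; unfold Rdiv; rewrite Rinv_0; lra.
Qed.

Lemma positive_lower_bound n (f : nat -> R) :
  exists m, 0 < m /\ forall i, (i < n)%nat -> 0 < f i -> m <= f i.
Proof.
  induction n as [|n [m [Hm H]]].
  - exists 1; split; [lra|intros; lia].
  - destruct (Rlt_le_dec 0 (f n)) as [Hf|Hf].
    + exists (Rmin m (f n)); split; [now apply Rmin_glb_lt|].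
      intros i Hi Hp; destruct (Nat.eq_dec i n) as [->|]; [apply Rmin_r|].
      eapply Rle_trans; [apply Rmin_l|apply H; auto; lia].
    + exists m; split; [assumption|]; intros i Hi Hp.
      destruct (Nat.eq_dec i n) as [->|]; [lra|apply H; auto; lia].
Qed.

Lemma positive_lower_bound2 n l (f : nat -> nat -> R) :
  exists m, 0 < m /\ forall i j, (i < n)%nat -> (j < l)%nat -> 0 < f i j -> m <= f i j.
Proof.
  induction n as [|n [m [Hm H]]].
  - exists 1; split; [lra|intros; lia].
  - destruct (positive_lower_bound l (f n)) as [m' [Hm' H']].
    exists (Rmin m m'); split; [now apply Rmin_glb_lt|].
    intros i j Hi Hj Hp; destruct (Nat.eq_dec i n) as [->|].
    + eapply Rle_trans; [apply Rmin_r|auto].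
    + eapply Rle_trans; [apply Rmin_l|apply H; auto; lia].
Qed.

Lemma fsum_outd N L P W : distr N P -> stoch N L W -> fsum L (outd N P W) = 1.
Proof.
  intros [HP H1] HW; unfold outd; rewrite fsum_swap, <- H1; apply fsum_ext; intros x Hx.
  rewrite fsum_scal, (proj2 (HW x Hx)); ring.
Qed.

Section Perturbation.

Variables (N L : nat) (W : bool -> nat -> nat -> R) (Pstar : nat -> R).
Hypothesis HW : forall k, stoch N L (W k).
Hypothesis HPs : distr N Pstar.
Hypothesis Hpos : forall x, (x < N)%nat -> 0 < Pstar x.

Local Notation I k P := (info N L P (W k)).
Local Notation q0 k := (outd N Pstar (W k)).

(** As a function of [x], this is the gradient of [I_k] at [Pstar], up to an additive constant. *)
Definition kl (k : bool) (x : nat) : R := fsum L (fun y => W k x y * ln (W k x y / q0 k y)).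

Definition outkl (k : bool) (P : nat -> R) : R :=
  fsum L (fun y => outd N P (W k) y * ln (outd N P (W k) y / q0 k y)).

Lemma W_nonneg k x y : (x < N)%nat -> (y < L)%nat -> 0 <= W k x y.
Proof. intros Hx Hy; now apply (HW k x Hx). Qed.

Lemma outd_pos_term P k x y : distr N P -> (x < N)%nat -> (y < L)%nat -> 0 < P x -> 0 < W k x y ->
  0 < outd N P (W k) y.
Proof.
  intros HP Hx Hy H1 H2; apply (outd_pos N L W (fun _ => P) HW (fun _ => HP) true k x); auto.
Qed.

Lemma outd_nonneg_gen P k y : distr N P -> (y < L)%nat -> 0 <= outd N P (W k) y.
Proof. intros HP; apply (outd_nonneg N L W (fun _ => P) HW (fun _ => HP) true k). Qed.

Lemma outd_abs_cont P k y : distr N P -> (y < L)%nat -> 0 < outd N P (W k) y -> 0 < q0 k y.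
Proof.
  intros HP Hy Ho; destruct (outd_nonneg_gen Pstar k y HPs Hy) as [H|H]; [assumption|exfalso].
  assert (Hz : outd N P (W k) y = 0); [|lra].
  apply fsum_zero; intros x Hx.
  assert (Hx0 : Pstar x * W k x y = 0).
  { apply (fsum_nonneg_zero N (fun x => Pstar x * W k x y)); auto.
    - intros i Hi; apply Rmult_le_pos; [now apply HPs|now apply W_nonneg].
    - unfold outd in H; lra. }
  pose proof (Hpos x Hx); apply Rmult_integral in Hx0; destruct Hx0 as [E|E]; [lra|rewrite E; ring].
Qed.

(** Compensation identity: a part linear in [P], minus a divergence between output laws that is of
    second order at [Pstar]. *)
Lemma info_decomposition k P : distr N P -> I k P = fsum N (fun x => P x * kl k x) - outkl k P.
Proof.
  intros HP; unfold outkl.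
  rewrite (fsum_ext L _ (fun y => fsum N (fun x =>
    P x * (W k x y * ln (outd N P (W k) y / q0 k y))))).
  2:{ intros y _; unfold outd at 1; rewrite Rmult_comm, <- fsum_scal.
      apply fsum_ext; intros; ring. }
  rewrite fsum_swap, <- fsum_sub; unfold info; apply fsum_ext; intros x Hx.
  rewrite fsum_scal, <- Rmult_minus_distr_l; unfold kl; rewrite <- fsum_sub.
  destruct (proj1 HP x Hx) as [HPx|HPx]; [|rewrite <- HPx; ring].
  f_equal; apply fsum_ext; intros y Hy.
  destruct (W_nonneg k x y Hx Hy) as [Hw|Hw]; [|rewrite <- Hw; ring].
  rewrite <- Rmult_minus_distr_l; f_equal; unfold idens.
  assert (H1 : 0 < outd N P (W k) y) by now apply (outd_pos_term P k x y).
  assert (H2 : 0 < q0 k y) by now apply (outd_abs_cont P).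
  replace (W k x y / q0 k y) with (W k x y / outd N P (W k) y * (outd N P (W k) y / q0 k y))
    by (field; lra).
  rewrite ln_mult by (apply Rdiv_lt_0_compat; assumption); ring.
Qed.

Lemma info_star k : I k Pstar = fsum N (fun x => Pstar x * kl k x).
Proof. reflexivity. Qed.

Lemma outkl_nonneg k P : distr N P -> 0 <= outkl k P.
Proof.
  intros HP; pose proof (kl_lower L (outd N P (W k)) (q0 k)) as H.
  rewrite !fsum_outd in H by auto; unfold outkl; apply Rle_trans with (1 - 1); [lra|apply H].
  intros y Hy; repeat split; auto using outd_nonneg_gen; now apply outd_abs_cont.
Qed.

Lemma kl_nonneg k x : (x < N)%nat -> 0 <= kl k x.
Proof.
  intros Hx; pose proof (kl_lower L (W k x) (q0 k)) as H.
  rewrite fsum_outd, (proj2 (HW k x Hx)) in H by auto.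
  apply Rle_trans with (1 - 1); [lra|apply H].
  intros y Hy; repeat split; auto using outd_nonneg_gen, W_nonneg.
  intros Hw; now apply (outd_pos_term Pstar k x y HPs); auto.
Qed.

Lemma info_le_linear k P : distr N P -> I k P <= fsum N (fun x => P x * kl k x).
Proof.
  intros HP; rewrite info_decomposition by assumption.
  pose proof (outkl_nonneg k P HP); lra.
Qed.

Definition dot (u v : nat -> R) : R := fsum N (fun x => u x * v x).

(** The upper bound is [outkl >= 0]. For the lower one, the chi-square bound on [outkl] is exactly a
    constant times [t^2], as output laws are affine in [t]. *)
Lemma perturbation (v : nat -> R) : fsum N v = 0 ->
  exists d0 K, 0 < d0 /\ 0 <= K /\ forall t, Rabs t <= d0 ->
    let P := fun x => Pstar x + t * v x in
    distr N P /\ (forall x, (x < N)%nat -> Pstar x / 2 <= P x) /\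
    forall k, I k Pstar + t * dot v (kl k) - K * t ^ 2 <= I k P
              <= I k Pstar + t * dot v (kl k).
Proof.
  intros Hv.
  destruct (positive_lower_bound N Pstar) as [pm [Hpm Hmin]].
  set (V := fsum N (fun x => Rabs (v x))).
  assert (HV : 0 <= V) by (apply fsum_nonneg; intros; apply Rabs_pos).
  set (chi := fun k => fsum L (fun y => (fsum N (fun x => v x * W k x y)) ^ 2 / q0 k y)).
  assert (Hchi : forall k, 0 <= chi k).
  { intros k; apply fsum_nonneg; intros y Hy.
    destruct (outd_nonneg_gen Pstar k y HPs Hy) as [H|H].
    - apply Rmult_le_pos; [apply pow2_ge_0|now apply Rlt_le, Rinv_0_lt_compat].
    - rewrite <- H; unfold Rdiv; rewrite Rinv_0; lra. }
  (* This radius gives [|t * v x| <= pm / 2], so at least half of each [Pstar x] survives. *)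
  exists (pm / (2 * (1 + V))), (chi true + chi false).
  split; [apply Rdiv_lt_0_compat; lra|].
  split; [pose proof (Hchi true); pose proof (Hchi false); lra|].
  intros t Ht P.
  assert (Hhalf : forall x, (x < N)%nat -> Pstar x / 2 <= P x).
  { intros x Hx; unfold P.
    assert (Hvx : Rabs (v x) <= V)
      by (apply (fsum_ge_term N (fun x => Rabs (v x))); auto; intros; apply Rabs_pos).
    assert (Htv : Rabs (t * v x) <= pm / 2).
    { rewrite Rabs_mult; apply Rle_trans with (pm / (2 * (1 + V)) * (1 + V)).
      - apply Rmult_le_compat; auto using Rabs_pos; lra.
      - apply Req_le; field; lra. }
    pose proof (Hmin x Hx (Hpos x Hx)).
    pose proof (Rle_abs (- (t * v x))) as Hn; rewrite Rabs_Ropp in Hn; lra. }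
  assert (HP : distr N P).
  { split.
    - intros x Hx; pose proof (Hhalf x Hx); pose proof (Hpos x Hx); lra.
    - unfold P; rewrite fsum_add, fsum_scal, Hv, (proj2 HPs); ring. }
  split; [assumption|]; split; [assumption|]; intros k.
  assert (Hlin : fsum N (fun x => P x * kl k x) = I k Pstar + t * dot v (kl k)).
  { rewrite info_star; unfold P, dot; rewrite <- fsum_scal, <- fsum_add.
    apply fsum_ext; intros; ring. }
  assert (Hout : outkl k P <= chi k * t ^ 2).
  { unfold outkl; eapply Rle_trans; [apply (kl_upper L (outd N P (W k)) (q0 k))|].
    - intros y Hy; repeat split; auto using outd_nonneg_gen; now apply outd_abs_cont.
    - rewrite !fsum_outd by auto; unfold chi.
      rewrite Rmult_comm, <- fsum_scal, Rminus_diag, Rplus_0_r.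
      apply Req_le, fsum_ext; intros y _.
      replace (outd N P (W k) y) with (q0 k y + t * fsum N (fun x => v x * W k x y)).
      + unfold Rdiv; ring.
      + unfold outd, P; rewrite <- fsum_scal, <- fsum_add; apply fsum_ext; intros; ring. }
  rewrite <- Hlin; split; [|now apply info_le_linear].
  rewrite info_decomposition by assumption.
  pose proof (Hchi true); pose proof (Hchi false); pose proof (pow2_ge_0 t).
  destruct k; nra.
Qed.

(** * First-order conditions at the optimal input distribution *)

Hypothesis Hmax : forall P, distr N P ->
  Rmin (I true P) (I false P) <= Rmin (I true Pstar) (I false Pstar).
Hypothesis Hlub : forall k Ck, is_lub (fun r => exists P, distr N P /\ r = I k P) Ck ->
  Rmin (I true Pstar) (I false Pstar) < Ck.

Local Notation C := (Rmin (I true Pstar) (I false Pstar)).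

Lemma C_le k : C <= I k Pstar.
Proof. destruct k; [apply Rmin_l|apply Rmin_r]. Qed.

(** Otherwise a short step along [v] lifts both informations above [C]: by a positive slope beating
    the quadratic loss, or by slack already present at [Pstar]. *)
Lemma no_improvement (v : nat -> R) : fsum N v = 0 ->
  exists k, I k Pstar = C /\ dot v (kl k) <= 0.
Proof.
  intros Hv; apply NNPP; intros Hno.
  destruct (perturbation v Hv) as (d0 & K & Hd0 & HK & Hpert).
  assert (Hk : forall k, exists t0, 0 < t0 <= d0 /\ forall t, 0 < t <= t0 ->
    C < I k (fun x => Pstar x + t * v x)).
  { intros k.
    assert (Hlow : forall t, 0 < t <= d0 ->
      I k Pstar + t * dot v (kl k) - K * t ^ 2 <= I k (fun x => Pstar x + t * v x)).
    { intros t Ht; apply (Hpert t); rewrite Rabs_pos_eq; lra. }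
    pose proof (C_le k) as HCk.
    destruct (Rlt_le_dec 0 (dot v (kl k))) as [Hg|Hg].
    - set (t1 := dot v (kl k) / (K + 1)).
      assert (Ht1 : 0 < t1) by (apply Rdiv_lt_0_compat; lra).
      assert (Ht1' : t1 * (K + 1) = dot v (kl k)) by (unfold t1; field; lra).
      exists (Rmin d0 t1); pose proof (Rmin_l d0 t1); pose proof (Rmin_r d0 t1).
      split; [split; [now apply Rmin_glb_lt|assumption]|]; intros t Ht.
      pose proof (Hlow t ltac:(lra)).
      assert (0 < t * (dot v (kl k) - K * t)) by (apply Rmult_lt_0_compat; nra).
      nra.
    - assert (HCk' : C < I k Pstar).
      { destruct HCk as [|E]; [assumption|]; exfalso; apply Hno; exists k; split; auto. }
      set (D := - dot v (kl k) + K + 1).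
      set (t1 := (I k Pstar - C) / D).
      assert (HD : 0 < D) by (unfold D; lra).
      assert (Ht1 : 0 < t1) by (apply Rdiv_lt_0_compat; lra).
      assert (Ht1' : t1 * D = I k Pstar - C) by (unfold t1; field; lra).
      exists (Rmin d0 (Rmin 1 t1)).
      pose proof (Rmin_l d0 (Rmin 1 t1)); pose proof (Rmin_r d0 (Rmin 1 t1)).
      pose proof (Rmin_l 1 t1); pose proof (Rmin_r 1 t1).
      split; [split; [repeat apply Rmin_glb_lt; lra|assumption]|]; intros t Ht.
      pose proof (Hlow t ltac:(lra)).
      assert (t * D <= t1 * D) by (apply Rmult_le_compat_r; lra).
      assert (0 <= K * (t * (1 - t))) by (repeat apply Rmult_le_pos; lra).
      assert (t * D = t * - dot v (kl k) + t * K + t) by (unfold D; ring).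
      lra. }
  destruct (Hk true) as (t1 & Ht1 & H1); destruct (Hk false) as (t2 & Ht2 & H2).
  set (t := Rmin t1 t2).
  assert (0 < t) by (apply Rmin_glb_lt; lra).
  assert (t <= t1) by apply Rmin_l; assert (t <= t2) by apply Rmin_r.
  specialize (H1 t ltac:(lra)); specialize (H2 t ltac:(lra)).
  destruct (Hpert t) as (HP & _); [rewrite Rabs_pos_eq; lra|].
  pose proof (Hmax _ HP) as Hm.
  pose proof (Rmin_glb_lt _ _ _ H1 H2); lra.
Qed.

(** The gradient projected onto the zero-sum directions, those tangent to the simplex. *)
Definition centered (k : bool) (x : nat) : R := kl k x - fsum N (kl k) / INR N.

Lemma N_pos : 0 < INR N.
Proof. apply lt_0_INR, (distr_pos_dim N _ HPs). Qed.

Lemma fsum_centered k : fsum N (centered k) = 0.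
Proof.
  unfold centered; rewrite fsum_sub, fsum_const; pose proof N_pos; field; lra.
Qed.

Lemma dot_centered u k : fsum N u = 0 -> dot u (kl k) = dot u (centered k).
Proof.
  intros Hu; unfold dot, centered.
  rewrite (fsum_ext N (fun x => u x * (kl k x - fsum N (kl k) / INR N))
    (fun x => u x * kl k x - fsum N (kl k) / INR N * u x)) by (intros; ring).
  rewrite fsum_sub, fsum_scal, Hu; ring.
Qed.

Lemma dot_self_zero u : dot u u <= 0 -> forall x, (x < N)%nat -> u x = 0.
Proof.
  intros H x Hx.
  pose proof (fsum_nonneg_zero N (fun x => u x * u x) ltac:(intros; nra) H x Hx) as E; simpl in E.
  now apply Rmult_integral in E; destruct E.
Qed.

(** With a vanishing projected gradient the tangent bound is constant, so [Pstar] maximizes [I_k]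
    and [C_k] is attained there. *)
Lemma centered_zero k : dot (centered k) (centered k) <= 0 -> C < I k Pstar.
Proof.
  intros H; apply (Hlub k).
  assert (Hc : forall P, distr N P ->
    fsum N (fun x => P x * kl k x) = fsum N (kl k) / INR N).
  { intros P HP; rewrite (fsum_ext N _ (fun x => fsum N (kl k) / INR N * P x)).
    - rewrite fsum_scal, (proj2 HP); ring.
    - intros x Hx; pose proof (dot_self_zero _ H x Hx) as E; unfold centered in E.
      replace (kl k x) with (fsum N (kl k) / INR N) by lra; ring. }
  split.
  - intros r (P & HP & ->); rewrite info_star, Hc, <- (Hc P) by assumption.
    now apply info_le_linear.
  - intros b Hb; apply Hb; exists Pstar; auto.
Qed.

(** If one information exceeded [C], only the other would be binding. Moving along its own gradient
    cannot help, so that gradient vanishes, and [centered_zero] contradicts its being binding. *)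
Lemma info_equal k : I k Pstar = C.
Proof.
  assert (Hle : forall k, ~ C < I k Pstar).
  { intros k' H.
    assert (E : I (negb k') Pstar = C).
    { unfold Rmin in *; destruct (Rle_dec (I true Pstar) (I false Pstar)), k'; simpl; lra. }
    destruct (no_improvement (centered (negb k')) (fsum_centered _)) as (k2 & E2 & Hd).
    assert (k2 = negb k') as -> by (destruct k2, k'; simpl; auto; exfalso; lra).
    rewrite dot_centered in Hd by apply fsum_centered.
    apply centered_zero in Hd; lra. }
  apply Rle_antisym; [apply Rnot_lt_le, Hle|apply C_le].
Qed.

Lemma centered_pos k : 0 < dot (centered k) (centered k).
Proof.
  destruct (Rlt_le_dec 0 (dot (centered k) (centered k))) as [|H]; [assumption|].
  apply centered_zero in H; pose proof (info_equal k); lra.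
Qed.

Lemma capacity_pos : 0 < C.
Proof.
  destruct (Rlt_le_dec 0 C) as [|H]; [assumption|exfalso].
  assert (Hz : forall x, (x < N)%nat -> kl true x = 0).
  { intros x Hx.
    assert (E : Pstar x * kl true x = 0).
    { apply (fsum_nonneg_zero N (fun x => Pstar x * kl true x)); auto.
      - intros i Hi; apply Rmult_le_pos; [apply Rlt_le, Hpos, Hi|now apply kl_nonneg].
      - rewrite <- info_star; pose proof (info_equal true); lra. }
    pose proof (Hpos x Hx); apply Rmult_integral in E; destruct E; lra. }
  pose proof (centered_pos true) as Hp.
  assert (E : dot (centered true) (centered true) = 0); [|lra].
  apply fsum_zero; intros x Hx; unfold centered.
  rewrite Hz, (fsum_zero N (kl true)) by auto; unfold Rdiv; ring.
Qed.

(* Equality case of Cauchy-Schwarz: if the two gradients were not opposite, their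
   normalized sum would increase both mutual informations. *)
Lemma opposite_gradients : exists al be, 0 < al /\ 0 < be /\
  dot (centered true) (kl true) = al ^ 2 /\ dot (centered true) (kl false) = - (al * be).
Proof.
  set (v1 := centered true); set (v2 := centered false).
  set (al := sqrt (dot v1 v1)); set (be := sqrt (dot v2 v2)).
  pose proof (centered_pos true : 0 < dot v1 v1) as P1.
  pose proof (centered_pos false : 0 < dot v2 v2) as P2.
  assert (Hal : 0 < al) by now apply sqrt_lt_R0.
  assert (Hbe : 0 < be) by now apply sqrt_lt_R0.
  assert (Eal : dot v1 v1 = al ^ 2) by (unfold al; rewrite pow2_sqrt; lra).
  assert (Ebe : dot v2 v2 = be ^ 2) by (unfold be; rewrite pow2_sqrt; lra).
  set (v := fun x => be * v1 x + al * v2 x).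
  assert (Hv : fsum N v = 0).
  { unfold v; rewrite fsum_add, !fsum_scal; unfold v1, v2; rewrite !fsum_centered; ring. }
  assert (Hdv : forall u, dot v u = be * dot v1 u + al * dot v2 u).
  { intros u; unfold dot, v; rewrite <- !fsum_scal, <- fsum_add; apply fsum_ext; intros; ring. }
  assert (Hsym : dot v2 v1 = dot v1 v2) by (apply fsum_ext; intros; ring).
  assert (Hp : dot v1 v2 <= - (al * be)).
  { destruct (no_improvement v Hv) as (k & _ & Hk).
    rewrite dot_centered in Hk by assumption.
    destruct k; [fold v1 in Hk|fold v2 in Hk]; rewrite Hdv, ?Hsym, ?Eal, ?Ebe in Hk.
    - assert (al * (al * be + dot v1 v2) <= 0) by lra; nra.
    - assert (be * (al * be + dot v1 v2) <= 0) by lra; nra. }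
  (* Expanding, [dot v v = 2 * al * be * (al * be + dot v1 v2)], so [Hp] forces [v = 0]. *)
  assert (Hvv : dot v v <= 0).
  { assert (E : dot v v = be * dot v1 v + al * dot v2 v) by apply Hdv.
    assert (E1 : forall u, dot u v = dot v u) by (intros; apply fsum_ext; intros; ring).
    rewrite (E1 v1), (E1 v2), (Hdv v1), (Hdv v2), Eal, Ebe, Hsym in E.
    rewrite E; assert (0 < al * be) by now apply Rmult_lt_0_compat.
    assert (al * be * (al * be + dot v1 v2) <= 0) by nra; nra. }
  pose proof (dot_self_zero v Hvv) as Hz.
  exists al, be; repeat split; auto.
  - now rewrite dot_centered by apply fsum_centered.
  - rewrite dot_centered by apply fsum_centered; fold v1 v2.
    assert (E : dot v v1 = 0).
    { apply fsum_zero; intros x Hx; rewrite Hz by assumption; ring. }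
    rewrite Hdv, Hsym, Eal in E.
    apply Rmult_eq_reg_l with al; [|lra]; lra.
Qed.

(** One [c] has to serve all perturbation sizes, because it enters constants that may not depend on
    the blocklength. *)
Lemma ratio_log_bound : exists c, 0 < c /\
  forall (P : bool -> nat -> R), (forall s, distr N (P s)) ->
  (forall s x, (x < N)%nat -> Pstar x / 2 <= P s x) ->
  forall k s x y, (x < N)%nat -> (y < L)%nat -> 0 < W k x y ->
  Rabs (ln (ratio N W P k s x y)) <= c.
Proof.
  destruct (positive_lower_bound N Pstar) as [pm [Hpm Hmin]].
  destruct (positive_lower_bound2 N L (W true)) as [w1 [Hw1 Hm1]].
  destruct (positive_lower_bound2 N L (W false)) as [w2 [Hw2 Hm2]].
  set (wm := Rmin w1 w2).
  assert (Hwm : 0 < wm) by now apply Rmin_glb_lt.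
  exists (1 + Rabs (ln (2 / pm)) + Rabs (ln wm)).
  split; [pose proof (Rabs_pos (ln (2 / pm))); pose proof (Rabs_pos (ln wm)); lra|].
  intros P HP Hhalf k s x y Hx Hy Hw.
  assert (Hwm' : wm <= W k x y).
  { destruct k; [eapply Rle_trans; [apply Rmin_l|auto]|eapply Rle_trans; [apply Rmin_r|auto]]. }
  pose proof (Hhalf s x Hx) as HPx; pose proof (Hmin x Hx (Hpos x Hx)) as Hpx.
  assert (Ho1 : P s x * W k x y <= outd N (P s) (W k) y).
  { apply (fsum_ge_term N (fun x => P s x * W k x y)); [|assumption].
    intros i Hi; apply Rmult_le_pos; [now apply (HP s)|now apply W_nonneg]. }
  assert (Ho2 : outd N (P s) (W k) y <= 1).
  { rewrite <- (fsum_outd N L (P s) (W k)) by auto.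
    apply (fsum_ge_term L (outd N (P s) (W k))); [|assumption].
    intros; now apply outd_nonneg_gen. }
  assert (Ho : 0 < outd N (P s) (W k) y) by nra.
  assert (R1 : ratio N W P k s x y <= 2 / pm).
  { unfold ratio; apply Rmult_le_reg_r with (outd N (P s) (W k) y * pm); [nra|].
    replace (W k x y / outd N (P s) (W k) y * (outd N (P s) (W k) y * pm))
      with (W k x y * pm) by (field; lra).
    replace (2 / pm * (outd N (P s) (W k) y * pm)) with (2 * outd N (P s) (W k) y)
      by (field; lra).
    nra. }
  assert (R2 : wm <= ratio N W P k s x y).
  { unfold ratio; apply Rmult_le_reg_r with (outd N (P s) (W k) y); [assumption|].
    replace (W k x y / outd N (P s) (W k) y * outd N (P s) (W k) y)
      with (W k x y) by (field; lra).
    nra. }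
  assert (R3 : ln (ratio N W P k s x y) <= ln (2 / pm)) by (apply ln_le_compat; lra).
  assert (R4 : ln wm <= ln (ratio N W P k s x y)) by now apply ln_le_compat.
  apply Rabs_le.
  pose proof (Rle_abs (ln (2 / pm))); pose proof (Rabs_pos (ln (2 / pm))).
  pose proof (Rle_abs (- ln wm)) as Hn; rewrite Rabs_Ropp in Hn; pose proof (Rabs_pos (ln wm)).
  lra.
Qed.

Lemma steering : exists lam c g g' K d0 (v : nat -> R),
  0 <= lam <= 1 /\ 0 < c /\ 0 < g /\ 0 < g' /\ 0 <= K /\ 0 < d0 /\
  forall d, 0 < d <= d0 ->
  let P := fun (s : bool) x => Pstar x + (if s then - d else d) * v x in
  (forall s, distr N (P s)) /\ (forall s x, (x < N)%nat -> 0 < P s x) /\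
  (forall k s x y, (x < N)%nat -> (y < L)%nat -> 0 < W k x y ->
     Rabs (ln (ratio N W P k s x y)) <= c) /\
  (forall s, C - K * d ^ 2 <= lam * I true (P s) + (1 - lam) * I false (P s)) /\
  (forall k s, C / 2 <= I k (P s)) /\
  (forall e, sgn e * (I true (P e) - I false (P e)) <= - (g * d)) /\
  (forall e, sgn e * (I true (P (negb e)) - I false (P (negb e))) <= g' * d).
Proof.
  destruct opposite_gradients as (al & be & Hal & Hbe & E1 & E2).
  destruct (perturbation (centered true) (fsum_centered true)) as (d0 & K & Hd0 & HK & Hpert).
  destruct ratio_log_bound as (c & Hc & Hratio).
  pose proof capacity_pos as HC; set (C0 := C) in *.
  assert (Hg : 0 < al ^ 2 + al * be) by nra.
  assert (Hab : 0 < al * be) by now apply Rmult_lt_0_compat.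
  set (g := (al ^ 2 + al * be) / 2).
  assert (Hg2 : 2 * g = al ^ 2 + al * be) by (unfold g; lra).
  (* The last three caps give [K d^2 <= K d], [K d^2 <= g d] and informations of at least
     [C / 2]. *)
  set (d1 := Rmin (Rmin d0 1) (Rmin (g / (K + 1)) (C0 / 2 / (2 * g + K)))).
  assert (Hd1 : 0 < d1).
  { unfold d1; repeat apply Rmin_glb_lt; try lra; apply Rdiv_lt_0_compat; lra. }
  (* This weight cancels the slopes [al^2] and [- al * be]. The gap drifts at [2 * g * d] up to
     [K d^2 <= g d], whence [g] and [3 * g]. *)
  exists (be / (al + be)), c, g, (3 * g), K, d1, (centered true).
  assert (Hlam : be / (al + be) * (al + be) = be) by (field; lra).
  set (lam := be / (al + be)) in *.
  assert (Hlam01 : 0 <= lam <= 1).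
  { split.
    - apply Rlt_le, Rdiv_lt_0_compat; lra.
    - apply Rmult_le_reg_r with (al + be); lra. }
  repeat (split; [lra|]).
  intros d Hd.
  assert (Hmin : forall a b : R, d <= Rmin a b -> d <= a /\ d <= b).
  { intros a b Hab'; pose proof (Rmin_l a b); pose proof (Rmin_r a b); lra. }
  destruct (Hmin _ _ (proj2 Hd)) as [B12 B34].
  destruct (Hmin _ _ B12) as [B1 B2]; destruct (Hmin _ _ B34) as [B3 B4].
  apply (Rmult_le_compat_r (K + 1)) in B3; [|lra].
  replace (g / (K + 1) * (K + 1)) with g in B3 by (field; lra).
  apply (Rmult_le_compat_r (2 * g + K)) in B4; [|lra].
  replace (C0 / 2 / (2 * g + K) * (2 * g + K)) with (C0 / 2) in B4 by (field; lra).
  assert (BK : K * d ^ 2 <= g * d) by nra.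
  assert (BK' : K * d ^ 2 <= K * d)
    by (apply Rmult_le_compat_l; nra).
  set (P := fun (s : bool) x => Pstar x + (if s then - d else d) * centered true x).
  assert (Hs : forall s : bool, distr N (P s) /\ (forall x, (x < N)%nat -> Pstar x / 2 <= P s x) /\
    forall k : bool, C0 + (if s then - d else d) * (if k then al ^ 2 else - (al * be)) - K * d ^ 2
      <= I k (P s) <= C0 + (if s then - d else d) * (if k then al ^ 2 else - (al * be))).
  { intros s; destruct (Hpert (if s then - d else d)) as (H1 & H2 & H3).
    - destruct s; rewrite ?Rabs_Ropp, Rabs_pos_eq; lra.
    - split; [exact H1|]; split; [exact H2|]; intros k; specialize (H3 k).
      replace (I k Pstar) with C0 in H3 by (symmetry; apply info_equal).
      replace ((if s then - d else d) ^ 2) with (d ^ 2) in H3 by (destruct s; ring).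
      destruct k; rewrite ?E1, ?E2 in H3; exact H3. }
  split; [intros s; apply Hs|].
  split; [intros s x Hx; destruct (Hs s) as (_ & H & _); pose proof (H x Hx);
    pose proof (Hpos x Hx); lra|].
  split; [apply Hratio; intros s; apply Hs|].
  assert (Hnull : lam * al ^ 2 - (1 - lam) * (al * be) = 0).
  { replace (lam * al ^ 2 - (1 - lam) * (al * be)) with (al * (lam * (al + be) - be)) by ring.
    rewrite Hlam; ring. }
  split.
  { intros s; destruct (Hs s) as (_ & _ & H); pose proof (H true) as H1; pose proof (H false) as H2.
    simpl in H1, H2.
    set (t := if s then - d else d) in *.
    apply Rle_trans with (lam * (C0 + t * al ^ 2 - K * d ^ 2)
      + (1 - lam) * (C0 + t * - (al * be) - K * d ^ 2)).
    - replace (lam * (C0 + t * al ^ 2 - K * d ^ 2) + (1 - lam) * (C0 + t * - (al * be) - K * d ^ 2))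
        with (C0 - K * d ^ 2 + t * (lam * al ^ 2 - (1 - lam) * (al * be))) by ring.
      rewrite Hnull; lra.
    - apply Rplus_le_compat; apply Rmult_le_compat_l; lra. }
  split.
  { intros k s; destruct (Hs s) as (_ & _ & H); specialize (H k).
    assert (d * al ^ 2 <= d * (2 * g)) by (apply Rmult_le_compat_l; nra).
    assert (d * (al * be) <= d * (2 * g)) by (apply Rmult_le_compat_l; nra).
    assert (0 <= d * al ^ 2) by (apply Rmult_le_pos; nra).
    assert (0 <= d * (al * be)) by (apply Rmult_le_pos; nra).
    destruct k, s; simpl in H; lra. }
  assert (Hgd : d * al ^ 2 + d * (al * be) = 2 * (g * d)) by nra.
  split; intros e; destruct (Hs e) as (_ & _ & H1); destruct (Hs (negb e)) as (_ & _ & H2);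
    pose proof (H1 true); pose proof (H1 false); pose proof (H2 true); pose proof (H2 false);
    destruct e; simpl in *; lra.
Qed.

End Perturbation.

(** * Choice of the code parameters *)

Lemma nat_ceiling x : 0 <= x -> exists n : nat, x < INR n <= x + 1.
Proof.
  intros Hx; destruct (archimed x) as [H1 H2].
  exists (Z.to_nat (up x)); rewrite INR_IZR_INZ, Z2Nat.id; [lra|].
  apply le_IZR; lra.
Qed.

Lemma nat_half_floor x : 1 <= x -> exists n : nat, (1 <= n)%nat /\ x / 2 <= INR n <= x.
Proof.
  intros Hx; destruct (nat_ceiling x ltac:(lra)) as [m Hm].
  destruct m as [|n]; [simpl in Hm; lra|]; rewrite S_INR in Hm.
  assert (Hn : (1 <= n)%nat) by (destruct n; [simpl in Hm; lra|lia]).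
  exists n; split; [assumption|].
  apply le_INR in Hn; simpl in Hn; lra.
Qed.

Lemma cube_le_exp z : 0 <= z -> z ^ 3 / 27 <= exp z.
Proof.
  intros Hz; replace z with (z / 3 + z / 3 + z / 3) at 2 by field.
  rewrite !exp_plus; pose proof (exp_ineq1_le (z / 3)) as H.
  assert (Hz3 : 0 <= z / 3) by lra; set (y := z / 3) in *.
  replace (z ^ 3 / 27) with (y * y * y) by (unfold y; field).
  repeat apply Rmult_le_compat; nra.
Qed.

Lemma div_INR_le a b : (0 < b)%nat -> INR (a / b) * INR b <= INR a.
Proof.
  intros Hb; rewrite <- mult_INR; apply le_INR.
  rewrite Nat.mul_comm; apply Nat.Div0.mul_div_le.
Qed.

Lemma pow2_exp n : 2 ^ n = exp (INR n * ln 2).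
Proof. rewrite <- Rpower_pow by lra; reflexivity. Qed.

Lemma ln2_le_1 : ln 2 <= 1.
Proof. pose proof (ln_le_minus_one 2); lra. Qed.

Section Rate.

Variables (N L : nat) (W : bool -> nat -> nat -> R).
Hypothesis HW : forall k, stoch N L (W k).
Variables (C lam c g g' K : R).
Hypothesis HC : 0 < C.
Hypothesis Hlam : 0 <= lam <= 1.
Hypothesis Hc : 0 < c.
Hypothesis Hg : 0 < g.
Hypothesis Hg' : 0 < g'.
Hypothesis HK : 0 <= K.

(** With exponent [th0 * d] the second-order term cancels the good drift [g * d] exactly; [k0 * d^2]
    is then the growth in the bad mode. [th1] serves the Chernoff bound with drift [C / 2]. *)
Let th0 := g / (8 * c ^ 2).
Let k0 := th0 * g' + 8 * th0 ^ 2 * c ^ 2.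
Let th1 := Rmin (C / (8 * c ^ 2)) (1 / (2 * c)).

Lemma th0_pos : 0 < th0.
Proof. unfold th0; apply Rdiv_lt_0_compat; nra. Qed.

Lemma k0_nonneg : 0 <= k0.
Proof.
  pose proof th0_pos; unfold k0.
  apply Rplus_le_le_0_compat; [apply Rmult_le_pos; lra|].
  apply Rmult_le_pos; [|apply pow2_ge_0]; pose proof (pow2_ge_0 th0); lra.
Qed.

Lemma th1_spec : 0 < th1 /\ th1 * c <= 1 / 2 /\ 8 * th1 * c ^ 2 <= C.
Proof.
  assert (H1 : 0 < C / (8 * c ^ 2)) by (apply Rdiv_lt_0_compat; nra).
  assert (H2 : 0 < 1 / (2 * c)) by (apply Rdiv_lt_0_compat; nra).
  pose proof (Rmin_l (C / (8 * c ^ 2)) (1 / (2 * c))) as L1.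
  pose proof (Rmin_r (C / (8 * c ^ 2)) (1 / (2 * c))) as L2; fold th1 in L1, L2.
  split; [now apply Rmin_glb_lt|]; split.
  - apply Rle_trans with (1 / (2 * c) * c); [apply Rmult_le_compat_r; lra|].
    apply Req_le; field; lra.
  - apply Rle_trans with (8 * (C / (8 * c ^ 2)) * c ^ 2).
    + apply Rmult_le_compat_r; [apply pow2_ge_0|lra].
    + apply Req_le; field; lra.
Qed.

(* [r] is the cube root of the blocklength, [r^2] the length of a block and [1/r] the
   size of the perturbation of the input distribution. *)
Lemma chain_estimates (P : bool -> nat -> R) (r gam : R) (B T : nat) :
  1 <= r -> 4 * c * th0 <= r -> 0 <= gam ->
  r ^ 2 < INR B <= r ^ 2 + 1 -> 8 * gam / C < INR T ->
  (forall s, distr N (P s)) -> (forall s x, (x < N)%nat -> 0 < P s x) ->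
  (forall k s x y, (x < N)%nat -> (y < L)%nat -> 0 < W k x y ->
     Rabs (ln (ratio N W P k s x y)) <= c) ->
  (forall s, C - K * (1 / r) ^ 2 <=
     lam * info N L (P s) (W true) + (1 - lam) * info N L (P s) (W false)) ->
  (forall k s, C / 2 <= info N L (P s) (W k)) ->
  (forall e, sgn e * (info N L (P e) (W true) - info N L (P e) (W false)) <= - (g * (1 / r))) ->
  (forall e, sgn e * (info N L (P (negb e)) (W true) - info N L (P (negb e)) (W false))
     <= g' * (1 / r)) ->
  (C - K * (1 / r) ^ 2) * fsum T (fun n => chain N L W P B gam n (undone gam))
    <= gam + c + (2 * k0 + ln (1 + INR T) + 2) * r / th0 /\
  chain N L W P B gam T (undone gam) <= 2 * exp (- (th1 * gam)).
Proof.
  intros Hr Hr4 Hgam HB HT HP Ppos Hratio Hdrift Hhalf Hgood Hbad.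
  pose proof th0_pos as Hth0; pose proof k0_nonneg as Hk0.
  destruct th1_spec as (Hth1 & Hth1c & Hth1C).
  assert (HBpos : (0 < B)%nat) by (apply INR_lt; simpl; nra).
  assert (Hd : 0 < 1 / r) by (apply Rdiv_lt_0_compat; lra).
  assert (Hdr : 1 / r * r = 1) by (field; lra).
  set (d := 1 / r) in *.
  assert (Hth0c : 8 * th0 * c ^ 2 = g) by (unfold th0; field; lra).
  split.
  - eapply Rle_trans.
    + apply (optional_stopping N L W P HW HP B gam HBpos Hgam Ppos c ltac:(lra) Hratio lam);
        [lra|exact Hdrift].
    + apply Rplus_le_compat_l.
      eapply Rle_trans.
      * apply (gap_chain N L W P HW HP B gam HBpos Hgam Ppos c ltac:(lra) Hratio
          (th0 * d) (k0 * d ^ 2)).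
        -- now apply Rmult_lt_0_compat.
        -- assert (Hx : 4 * c * th0 * d <= r * d) by (apply Rmult_le_compat_r; lra); lra.
        -- apply Rmult_le_pos; [assumption|apply pow2_ge_0].
        -- intros e; unfold drift; specialize (Hgood e).
           apply Rle_trans with (th0 * d * (- (g * d)) + 2 * (th0 * d) ^ 2 * (2 * c) ^ 2).
           ++ apply Rplus_le_compat_r, Rmult_le_compat_l; [|assumption].
              apply Rlt_le; now apply Rmult_lt_0_compat.
           ++ rewrite <- Hth0c; apply Req_le; ring.
        -- intros e; unfold drift; specialize (Hbad e).
           apply Rle_trans with (th0 * d * (g' * d) + 2 * (th0 * d) ^ 2 * (2 * c) ^ 2).
           ++ apply Rplus_le_compat_r, Rmult_le_compat_l; [|assumption].
              apply Rlt_le; now apply Rmult_lt_0_compat.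
           ++ unfold k0; apply Req_le; ring.
      * apply Rle_trans with ((2 * k0 + ln (1 + INR T) + 2) / (th0 * d)).
        -- apply Rmult_le_compat_r.
           { apply Rlt_le, Rinv_0_lt_compat; now apply Rmult_lt_0_compat. }
           (* What remains is that a whole bad block adds at most [2 * k0] to the exponent: its
              length is at most [2 r^2] and [d = 1 / r]. *)
           do 2 apply Rplus_le_compat_r.
           assert (Hx : d ^ 2 * INR B <= 2).
           { apply Rle_trans with (d ^ 2 * (2 * r ^ 2)).
             - apply Rmult_le_compat_l; [apply pow2_ge_0|nra].
             - apply Req_le; replace (d ^ 2 * (2 * r ^ 2)) with (2 * (d * r) ^ 2) by ring.
               rewrite Hdr; ring. }
           rewrite Rmult_assoc; nra.
        -- apply Req_le; unfold d; field; lra.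
  - eapply Rle_trans.
    + apply (chain_undone_le N L W P HW HP B gam HBpos Hgam Ppos c ltac:(lra) Hratio (C / 2) th1);
        auto.
    + apply Rmult_le_compat_l; [lra|]; apply exp_le_compat.
      assert (HTC : 8 * gam <= INR T * C).
      { apply Rle_trans with (8 * gam / C * C); [apply Req_le; field; lra|].
        apply Rmult_le_compat_r; lra. }
      assert (Hy : 2 * th1 ^ 2 * c ^ 2 <= th1 * C / 4) by nra.
      pose proof (pos_INR T) as HTpos.
      apply Rle_trans with (th1 * gam + INR T * (- (th1 * C / 4))).
      * apply Rplus_le_compat_l, Rmult_le_compat_l; lra.
      * assert (th1 * (8 * gam) <= th1 * (INR T * C)) by (apply Rmult_le_compat_l; lra). lra.
Qed.

Variables (eps d0 : R).
Hypothesis Heps : 0 < eps < 1.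
Hypothesis Hd0 : 0 < d0.
Hypothesis Hsteer : forall d, 0 < d <= d0 -> exists P : bool -> nat -> R,
  (forall s, distr N (P s)) /\ (forall s x, (x < N)%nat -> 0 < P s x) /\
  (forall k s x y, (x < N)%nat -> (y < L)%nat -> 0 < W k x y ->
     Rabs (ln (ratio N W P k s x y)) <= c) /\
  (forall s, C - K * d ^ 2 <=
     lam * info N L (P s) (W true) + (1 - lam) * info N L (P s) (W false)) /\
  (forall k s, C / 2 <= info N L (P s) (W k)) /\
  (forall e, sgn e * (info N L (P e) (W true) - info N L (P e) (W false)) <= - (g * d)) /\
  (forall e, sgn e * (info N L (P (negb e)) (W true) - info N L (P (negb e)) (W false))
     <= g' * d).

(** In units of [r * ln n], [k3] bounds the excess of the densities, [k6] the reduction of the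
    threshold and [k8] the total loss. [a * n] bounds [th1 * gam] from below, and [r0] adds up all
    lower bounds needed on [r]. *)
Let k3 := c + (2 * k0 + 4) / th0.
Let k4 := 1 / (1 - eps).
Let k6 := k3 + C * (k4 ^ 3 + 1) + K * k4.
Let k8 := k6 + 8 * k4 + 9.
Let a := th1 * C / 2.
Let r0 := 3 + 4 * c * th0 + 1 / d0 + 2 * K / C + 6 * k8 / C + (8 * k4 + 2)
          + 216 / a ^ 3 + k4 / eps.

Lemma vlf_code_large r : r0 <= r ->
  logMstar_ge N L (W true) (W false) (r ^ 3) eps
    (r ^ 3 * C / (1 - eps) - k8 * r * ln (r ^ 3)).
Proof.
  intros Hr.
  pose proof th0_pos as Hth0; pose proof k0_nonneg as Hk0.
  destruct th1_spec as (Hth1 & Hth1c & Hth1C).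
  assert (Hk4 : 1 < k4).
  { unfold k4; apply Rmult_lt_reg_r with (1 - eps); [lra|].
    replace (1 / (1 - eps) * (1 - eps)) with 1 by (field; lra); lra. }
  assert (Hk4e : k4 * (1 - eps) = 1) by (unfold k4; field; lra).
  assert (Hk3 : 0 < k3).
  { unfold k3; assert (0 < (2 * k0 + 4) / th0) by (apply Rdiv_lt_0_compat; lra); lra. }
  assert (Hk43 : 0 < k4 ^ 3) by (apply pow_lt; lra).
  assert (HCk : 0 < C * (k4 ^ 3 + 1)) by (apply Rmult_lt_0_compat; lra).
  assert (HKk : 0 <= K * k4) by (apply Rmult_le_pos; lra).
  assert (Hk6 : 0 < k6) by (unfold k6; lra).
  assert (Hk8 : k6 < k8) by (unfold k8; lra).
  assert (Ha : 0 < a) by (unfold a; nra).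
  assert (Ha3 : 0 < a ^ 3) by now apply pow_lt.
  assert (A1 : 0 < 4 * c * th0) by (apply Rmult_lt_0_compat; lra).
  assert (A2 : 0 < 1 / d0) by (apply Rdiv_lt_0_compat; lra).
  assert (A3 : 0 <= 2 * K / C) by (apply Rmult_le_pos; [lra|apply Rlt_le, Rinv_0_lt_compat; lra]).
  assert (A4 : 0 < 6 * k8 / C) by (apply Rdiv_lt_0_compat; lra).
  assert (A5 : 0 < 216 / a ^ 3) by (apply Rdiv_lt_0_compat; lra).
  assert (A6 : 0 < k4 / eps) by (apply Rdiv_lt_0_compat; lra).
  unfold r0 in Hr.
  assert (Hr3 : 3 <= r) by lra.
  assert (R2 : 1 / d0 <= r) by lra.
  assert (R3 : 2 * K / C <= r) by lra.
  assert (R4 : 6 * k8 / C <= r) by lra.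
  assert (R5 : 8 * k4 + 2 <= r) by lra.
  assert (R6 : 216 / a ^ 3 <= r) by lra.
  assert (R7 : k4 / eps <= r) by lra.
  assert (R1 : 4 * c * th0 <= r) by lra.
  clear Hr.
  apply (Rmult_le_compat_r C) in R3; [|lra].
  replace (2 * K / C * C) with (2 * K) in R3 by (field; lra).
  apply (Rmult_le_compat_r C) in R4; [|lra].
  replace (6 * k8 / C * C) with (6 * k8) in R4 by (field; lra).
  apply (Rmult_le_compat_r (a ^ 3)) in R6; [|lra].
  replace (216 / a ^ 3 * a ^ 3) with 216 in R6 by (field; lra).
  apply (Rmult_le_compat_r eps) in R7; [|lra].
  replace (k4 / eps * eps) with k4 in R7 by (field; lra).
  apply (Rmult_le_compat_r d0) in R2; [|lra].
  replace (1 / d0 * d0) with 1 in R2 by (field; lra).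
  set (n := r ^ 3); set (l := ln n).
  assert (Hn : n = r * r ^ 2) by (unfold n; ring).
  assert (Hr2 : r <= r ^ 2) by nra.
  assert (Hr9 : 9 <= r ^ 2) by nra.
  assert (Hnr : r ^ 2 <= n) by nra.
  assert (Hn0 : 0 < n) by lra.
  assert (Hl1 : 1 <= l).
  { unfold l; rewrite <- (ln_exp 1); apply ln_le_compat; [apply exp_pos|].
    pose proof exp_le_3; lra. }
  assert (Hlr : l <= 3 * r).
  { unfold l, n; rewrite ln_pow by lra; simpl INR.
    pose proof (ln_le_minus_one r ltac:(lra)); lra. }
  assert (Hrl : r <= r * l) by nra.
  assert (Hll : l <= r * l) by nra.
  assert (Hrl2 : r * l <= 3 * r ^ 2) by nra.
  set (gam := n * C * k4 - k6 * r * l).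
  assert (Hrlpos : 0 < r * l) by nra.
  assert (Hk8rl : 2 * (k8 * r * l) <= n * C).
  { apply Rle_trans with (2 * k8 * (3 * r ^ 2)).
    - rewrite Rmult_assoc, <- Rmult_assoc; apply Rmult_le_compat_l; lra.
    - replace (2 * k8 * (3 * r ^ 2)) with (6 * k8 * r ^ 2) by ring.
      rewrite Hn; replace (r * r ^ 2 * C) with (r * C * r ^ 2) by ring.
      apply Rmult_le_compat_r; lra. }
  assert (Hk6rl : k6 * r * l <= k8 * r * l).
  { rewrite !Rmult_assoc; apply Rmult_le_compat_r; lra. }
  assert (Hk6rl0 : 0 < k6 * r * l) by (rewrite Rmult_assoc; now apply Rmult_lt_0_compat).
  assert (HnC : 0 < n * C) by now apply Rmult_lt_0_compat.
  assert (HnCk : n * C <= n * C * k4) by nra.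
  assert (Hgam1 : n * C / 2 <= gam) by (unfold gam; lra).
  assert (Hgam2 : gam <= n * C * k4) by (unfold gam; lra).
  destruct (nat_ceiling (r ^ 2) ltac:(lra)) as [B HB].
  destruct (nat_ceiling (8 * gam / C)) as [T HT].
  { apply Rmult_le_pos; [lra|apply Rlt_le, Rinv_0_lt_compat; lra]. }
  destruct (Hsteer (1 / r)) as (P & HP & Ppos & Hratio & Hdrift & Hhalf & Hgood & Hbad).
  { split; [apply Rdiv_lt_0_compat; lra|].
    apply Rmult_le_reg_r with r; [lra|]; replace (1 / r * r) with 1 by (field; lra); lra. }
  destruct (chain_estimates P r gam B T) as [Htime Hlate]; auto; try lra.
  assert (HBpos : (0 < B)%nat) by (apply INR_lt; simpl; lra).
  assert (HTn : 8 * gam / C <= 8 * n * k4).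
  { apply Rmult_le_reg_r with C; [lra|].
    replace (8 * gam / C * C) with (8 * gam) by (field; lra); lra. }
  assert (HT2 : 1 + INR T <= n ^ 2).
  { apply Rle_trans with (n * (8 * k4 + 2)); [lra|].
    replace (n ^ 2) with (n * n) by ring; apply Rmult_le_compat_l; lra. }
  pose proof (pos_INR T) as HTpos.
  assert (HlnT : ln (1 + INR T) <= 2 * l).
  { unfold l; replace (2 * ln n) with (ln (n ^ 2)) by (rewrite ln_pow by lra; simpl INR; ring).
    apply ln_le_compat; lra. }
  set (C' := C - K * (1 / r) ^ 2) in *.
  assert (HC' : C' = C - K / r ^ 2) by (unfold C'; field; lra).
  assert (HKr : K / r ^ 2 <= C / 2).
  { apply Rmult_le_reg_r with (r ^ 2); [lra|].
    replace (K / r ^ 2 * r ^ 2) with K by (field; lra).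
    assert (r * C <= r ^ 2 * C) by (apply Rmult_le_compat_r; lra); lra. }
  assert (HC'pos : 0 < C') by lra.
  set (X := c + (2 * k0 + ln (1 + INR T) + 2) * r / th0) in *.
  assert (HX : X <= k3 * (r * l)).
  { unfold X, k3; rewrite (Rmult_plus_distr_r c); apply Rplus_le_compat.
    - assert (c * 1 <= c * (r * l)) by (apply Rmult_le_compat_l; lra); lra.
    - replace ((2 * k0 + 4) / th0 * (r * l)) with ((2 * k0 + 4) * (r * l) / th0) by (field; lra).
      unfold Rdiv; rewrite !(Rmult_comm _ (/ th0)).
      apply Rmult_le_compat_l; [apply Rlt_le, Rinv_0_lt_compat; lra|].
      replace ((2 * k0 + 4) * (r * l)) with ((2 * k0 + 4) * l * r) by ring.
      apply Rmult_le_compat_r; [lra|].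
      assert (2 * k0 * 1 <= 2 * k0 * l) by (apply Rmult_le_compat_l; lra); lra. }
  set (tau0 := (gam + X) / C').
  assert (Htau : fsum T (fun m => chain N L W P B gam m (undone gam)) <= tau0).
  { apply Rmult_le_reg_l with C'; [assumption|].
    replace (C' * tau0) with (gam + X) by (unfold tau0; field; lra).
    unfold X; lra. }
  (* The spare 1 is for lateness and confusion, one half each; [k4^2] compensates for giving up
     slightly less often than [eps]. *)
  assert (Htau1 : tau0 + 1 <= (n - k4 ^ 2) * k4).
  { assert (Hx : tau0 <= (n - k4 ^ 2) * k4 - 1); [|lra].
    apply Rmult_le_reg_r with C'; [assumption|].
    replace (tau0 * C') with (gam + X) by (unfold tau0; field; lra).
    apply Rle_trans with (n * C * k4 - C * (k4 ^ 3 + 1) - K * k4 * r).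
    - assert (C * (k4 ^ 3 + 1) * 1 <= C * (k4 ^ 3 + 1) * (r * l))
        by (apply Rmult_le_compat_l; lra).
      assert (K * k4 * r <= K * k4 * (r * l)) by (apply Rmult_le_compat_l; lra).
      unfold gam, k6; lra.
    - rewrite HC'.
      replace (((n - k4 ^ 2) * k4 - 1) * (C - K / r ^ 2))
        with (n * C * k4 - C * (k4 ^ 3 + 1) - K * k4 * (n / r ^ 2) + K / r ^ 2 * (k4 ^ 3 + 1))
        by (field; lra).
      replace (n / r ^ 2) with r by (rewrite Hn; field; lra).
      assert (0 <= K / r ^ 2 * (k4 ^ 3 + 1)); [|lra].
      apply Rmult_le_pos; [|lra].
      apply Rmult_le_pos; [lra|apply Rlt_le, Rinv_0_lt_compat; lra]. }
  assert (Hnb : INR (nblocks B T) <= 8 * k4 * r + 2).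
  { unfold nblocks; rewrite plus_INR; simpl (INR 1).
    assert (Hx : INR (T / B) * r ^ 2 <= (8 * k4 * r + 1) * r ^ 2).
    { apply Rle_trans with (INR (T / B) * INR B);
        [apply Rmult_le_compat_l; [apply pos_INR|lra]|].
      eapply Rle_trans; [now apply div_INR_le|].
      replace ((8 * k4 * r + 1) * r ^ 2) with (8 * (r * r ^ 2) * k4 + r ^ 2) by ring.
      rewrite <- Hn; lra. }
    apply Rmult_le_reg_r in Hx; lra. }
  pose proof ln2_le_1 as Hln2; pose proof ln_lt_2 as Hln2'.
  (* The deductions pay for the patterns, for the factors [A = n^2] and [T + 1] (at most [n^2] each,
     up to rounding), and for bringing the factor 2 of the two receivers down to one half. *)
  set (x := exp (gam - INR (nblocks B T) * ln 2 - 4 * l - 2 * ln 2)).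
  assert (HE : n * C * k4 - k8 * r * l <= gam - INR (nblocks B T) * ln 2 - 4 * l - 3 * ln 2).
  { assert (INR (nblocks B T) * ln 2 <= INR (nblocks B T) * 1)
      by (apply Rmult_le_compat_l; [apply pos_INR|lra]).
    assert (k4 * r <= k4 * (r * l)) by (apply Rmult_le_compat_l; lra).
    unfold gam, k8; lra. }
  destruct (nat_half_floor x) as [M [HM HMx]].
  { unfold x; rewrite <- exp_0; apply exp_le_compat; lra. }
  exists M; split.
  - set (Y := INR M * (n ^ 2 * (2 * (INR (S T) * (2 ^ nblocks B T * exp (- gam)))))).
    assert (HY : Y <= 1 / 2).
    { assert (Hpos2 : 0 < 2 ^ nblocks B T * exp (- gam))
        by (apply Rmult_lt_0_compat; [apply pow_lt; lra|apply exp_pos]).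
      assert (Hn2 : 0 < n ^ 2) by now apply pow_lt.
      apply Rle_trans with (x * (n ^ 2 * (2 * (n ^ 2 * (2 ^ nblocks B T * exp (- gam)))))).
      - unfold Y; apply Rmult_le_compat; [apply pos_INR| |lra|].
        + apply Rmult_le_pos; [lra|]; apply Rmult_le_pos; [lra|].
          apply Rmult_le_pos; [apply pos_INR|lra].
        + apply Rmult_le_compat_l; [lra|]; apply Rmult_le_compat_l; [lra|].
          apply Rmult_le_compat_r; [lra|]; rewrite S_INR; lra.
      - assert (Hn4 : n ^ 2 * n ^ 2 = exp (4 * l)).
        { replace (4 * l) with (l + l + l + l) by ring; rewrite !exp_plus.
          unfold l; rewrite exp_ln by lra; ring. }
        replace (x * (n ^ 2 * (2 * (n ^ 2 * (2 ^ nblocks B T * exp (- gam))))))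
          with (2 * (x * exp (- gam) * 2 ^ nblocks B T * (n ^ 2 * n ^ 2))) by ring.
        rewrite Hn4, pow2_exp; unfold x; rewrite <- !exp_plus.
        replace (gam - INR (nblocks B T) * ln 2 - 4 * l - 2 * ln 2 + - gam
          + INR (nblocks B T) * ln 2 + 4 * l) with (- (ln 2 + ln 2)) by ring.
        rewrite exp_Ropp, exp_plus, exp_ln by lra; lra. }
    set (l0 := 2 * exp (- (th1 * gam))) in *.
    assert (Hl0 : 2 * n ^ 2 * l0 <= 1 / 2).
    (* The constant 216 in [r0] is [8 * 27], with 27 from [cube_le_exp]. *)
    { assert (Hz : 8 * n ^ 2 <= exp (th1 * gam)).
      { apply Rle_trans with (exp (a * n)).
        - eapply Rle_trans; [|apply cube_le_exp; apply Rmult_le_pos; lra].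
          replace ((a * n) ^ 3 / 27) with (a ^ 3 * n / 27 * n ^ 2) by field.
          apply Rmult_le_compat_r; [apply pow2_ge_0|].
          assert (r * a ^ 3 <= n * a ^ 3) by (apply Rmult_le_compat_r; lra); lra.
        - apply exp_le_compat; unfold a.
          replace (th1 * C / 2 * n) with (th1 * (n * C / 2)) by field.
          apply Rmult_le_compat_l; lra. }
      unfold l0; rewrite exp_Ropp.
      pose proof (exp_pos (th1 * gam)) as He.
      apply Rmult_le_reg_r with (exp (th1 * gam)); [assumption|].
      replace (2 * n ^ 2 * (2 * / exp (th1 * gam)) * exp (th1 * gam)) with (4 * n ^ 2)
        by (field; lra); lra. }
    assert (HD : tau0 + 2 * n ^ 2 * l0 + Y <= (n - k4 ^ 2) * k4) by lra.
    assert (Hk4n : k4 / n <= eps).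
    { apply Rmult_le_reg_r with n; [lra|]; replace (k4 / n * n) with k4 by (field; lra).
      assert (r * eps <= n * eps) by (apply Rmult_le_compat_r; lra); lra. }
    assert (Hk4n0 : 0 < k4 / n) by (apply Rdiv_lt_0_compat; lra).
    (* As [D <= n * k4] and [A = n^2], errors outside the giving-up branch are at most [k4 / n],
       which is the amount withheld from [eps]. *)
    apply (vlf_code_of_chain N L W P HW HP B gam HBpos T M (eps - k4 / n) (n ^ 2) tau0 l0);
      auto; fold Y.
    + lra.
    + now apply pow_lt.
    + eapply Rle_trans; [apply Rmult_le_compat_l; [lra|exact HD]|].
      replace ((1 - (eps - k4 / n)) * ((n - k4 ^ 2) * k4))
        with ((n - k4 ^ 2) * (k4 * (1 - eps)) + k4 ^ 2 - k4 ^ 4 / n) by (field; lra).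
      rewrite Hk4e.
      assert (0 < k4 ^ 4 / n) by (apply Rdiv_lt_0_compat; [apply pow_lt|]; lra).
      fold n; lra.
    + apply Rle_trans with (eps - k4 / n + n * k4 / n ^ 2).
      * apply Rplus_le_compat_l, Rmult_le_compat_r.
        -- apply Rlt_le, Rinv_0_lt_compat; now apply pow_lt.
        -- eapply Rle_trans; [exact HD|].
           apply Rmult_le_compat_r; [lra|pose proof (pow2_ge_0 k4); lra].
      * apply Req_le; field; lra.
  - assert (Hlx : ln (x / 2) <= ln (INR M)).
    { apply ln_le_compat; [unfold x; pose proof (exp_pos (gam - INR (nblocks B T) * ln 2
        - 4 * l - 2 * ln 2)); lra|lra]. }
    eapply Rle_trans; [|exact Hlx].
    unfold Rdiv; rewrite ln_mult, ln_Rinv by (apply exp_pos || lra).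
    unfold x; rewrite ln_exp; fold n l.
    replace (n * C * / (1 - eps)) with (n * C * k4) by (unfold k4, Rdiv; ring).
    lra.
Qed.

Lemma vlf_rate : exists K0 n0 : R, forall nbar, n0 <= nbar ->
  logMstar_ge N L (W true) (W false) nbar eps
    (nbar * C / (1 - eps) - K0 * Rpower nbar (1 / 3) * ln nbar).
Proof.
  exists k8, (Rmax 1 r0 ^ 3); intros nbar Hn.
  pose proof (Rmax_l 1 r0) as M1; pose proof (Rmax_r 1 r0) as M2.
  assert (Hpos : 0 < nbar) by (eapply Rlt_le_trans; [|exact Hn]; apply pow_lt; lra).
  set (r := Rpower nbar (1 / 3)).
  assert (Hr0 : 0 < r) by apply exp_pos.
  assert (Hr : r ^ 3 = nbar).
  { rewrite <- Rpower_pow by assumption; unfold r; rewrite Rpower_mult.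
    replace (1 / 3 * INR 3) with 1 by (simpl; field); now apply Rpower_1. }
  rewrite <- Hr; apply vlf_code_large.
  apply Rle_trans with (Rmax 1 r0); [assumption|].
  destruct (Rle_lt_dec (Rmax 1 r0) r) as [|H]; [assumption|exfalso].
  assert (r ^ 3 < Rmax 1 r0 ^ 3); [|lra].
  set (s := Rmax 1 r0) in *; assert (r * r < s * s) by nra; simpl; nra.
Qed.

End Rate.

Theorem theorem8 (N L : nat) (W1 W2 : nat -> nat -> R) (Pstar : nat -> R) :
  stoch N L W1 -> stoch N L W2 ->
  distr N Pstar ->
  (forall P, distr N P ->
     Rmin (info N L P W1) (info N L P W2)
     <= Rmin (info N L Pstar W1) (info N L Pstar W2)) ->
  (forall P, distr N P ->
     Rmin (info N L P W1) (info N L P W2)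
     = Rmin (info N L Pstar W1) (info N L Pstar W2) ->
     forall x, (x < N)%nat -> P x = Pstar x) ->
  (forall x, (x < N)%nat -> 0 < Pstar x) ->
  0 < disp N L Pstar W1 -> 0 < disp N L Pstar W2 ->
  (forall Ck, is_lub (fun r => exists P, distr N P /\ r = info N L P W1) Ck ->
     Rmin (info N L Pstar W1) (info N L Pstar W2) < Ck) ->
  (forall Ck, is_lub (fun r => exists P, distr N P /\ r = info N L P W2) Ck ->
     Rmin (info N L Pstar W1) (info N L Pstar W2) < Ck) ->
  forall eps, 0 < eps < 1 ->
  exists K n0 : R, forall nbar : R, n0 <= nbar ->
    logMstar_ge N L W1 W2 nbar eps
      (nbar * Rmin (info N L Pstar W1) (info N L Pstar W2) / (1 - eps)
       - K * Rpower nbar (1/3) * ln nbar).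
Proof.
  intros HW1 HW2 HPs Hmax _ Hpos _ _ Hlub1 Hlub2 eps Heps.
  set (W := fun k : bool => if k then W1 else W2).
  assert (HW : forall k, stoch N L (W k)) by (intros []; assumption).
  assert (Hlub : forall k Ck, is_lub (fun r => exists P, distr N P /\ r = info N L P (W k)) Ck ->
    Rmin (info N L Pstar (W true)) (info N L Pstar (W false)) < Ck)
    by (intros []; assumption).
  destruct (steering N L W Pstar HW HPs Hpos Hmax Hlub)
    as (lam & c & g & g' & K & d0 & v & Hlam & Hc & Hg & Hg' & HK & Hd0 & Hsteer).
  apply (vlf_rate N L W HW _ lam c g g' K
    (capacity_pos N L W Pstar HW HPs Hpos Hmax Hlub) Hlam Hc Hg Hg' HK eps d0 Heps Hd0).
  intros d Hd; eexists; exact (Hsteer d Hd).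
Qed.
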